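(* Let $\alpha_1<1/2$ and $\rho>\rho_c$. Then only the ground state is macroscopically occupied (BEC of type I): $$\lim_{V\to\infty}\frac1V\langle N_{\mathbf{n}}\rangle^C_V(\rho)=\begin{cases}\rho-\rho_c,&\mathbf{n}=(1,1,1),\\0,&\mathbf{n}\neq(1,1,1).\end{cases}$$
   Context: Fix exponents $\alpha_1\ge\alpha_2\ge\alpha_3>0$ with $\alpha_1+\alpha_2+\alpha_3=1$ and $\Lambda_V=\{x\in\mathbb{R}^3:0\le x_j\le V^{\alpha_j}\}$. The one-particle Hamiltonian $-\Delta/2$ on $L^2(\Lambda_V)$ with Dirichlet boundary conditions has eigenvalues $\epsilon_{\mathbf{n},V}=\frac{\pi^2}{2}\sum_jn_j^2V^{-2\alpha_j}$, $\mathbf{n}\in\mathbb{N}^3$, $n_j\ge1$; $N_{\mathbf{n}}$ is the occupation number of the eigenstate indexed by $\mathbf{n}$. Perfect Bose gas at inverse temperature $\beta>0$; canonical state at density $\rho=N/V$: $\langle\cdot\rangle^C_V(\rho)=Z_V(N)^{-1}\mathrm{Tr}(\cdot\,e^{-\beta T_V^{(N)}})$ on the symmetric $N$-particle space; limit at fixed $\rho$: $N$ particles in volume $V=N/\rho$, $N\to\infty$. $F(\eta)=\frac{\sqrt2}{3\pi^2}\eta^{3/2}$, $\rho_c=\int_0^\infty(e^{\beta\eta}-1)^{-1}F(d\eta)$. *)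

(* Defs.v *)
From HB Require Import structures.
From mathcomp Require Import all_boot all_order all_algebra.
From mathcomp Require Import all_classical all_reals all_analysis.
Set Implicit Arguments. Unset Strict Implicit. Unset Printing Implicit Defensive.
Import Order.TTheory GRing.Theory Num.Theory.
Import numFieldNormedType.Exports.
Local Open Scope classical_set_scope.
Local Open Scope ring_scope.

Definition mode := (nat * nat * nat)%type.
Definition n1 (n : mode) : nat := n.1.1.
Definition n2 (n : mode) : nat := n.1.2.
Definition n3 (n : mode) : nat := n.2.
Definition is_mode (n : mode) : Prop := (0 < n1 n)%N /\ (0 < n2 n)%N /\ (0 < n3 n)%N.

(* Dirichlet eigenvalue eps_{n,V} = pi^2/2 * sum_j n_j^2 V^(-2 a_j) *)
Definition eps {R : realType} (a1 a2 a3 V : R) (n : mode) : R :=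
  pi ^+ 2 / 2 *
  ((n1 n)%:R ^+ 2 * V `^ (- (2 * a1)) + (n2 n)%:R ^+ 2 * V `^ (- (2 * a2))
   + (n3 n)%:R ^+ 2 * V `^ (- (2 * a3))).

(* Occupation-number configurations of the symmetric N-particle space:
   finitely supported m : mode -> nat, supported on physical modes, total N.
   These index the eigenbasis of T_V^(N) on the symmetric N-particle space. *)
Definition config (N : nat) : set (mode -> nat) :=
  [set m | finite_set [set n | m n <> 0%N]
         /\ (forall n, m n <> 0%N -> is_mode n)
         /\ (\sum_(n \in [set: mode]) m n)%N = N].

Definition weight {R : realType} (beta a1 a2 a3 V : R) (m : mode -> nat) : R :=
  expR (- beta * \sum_(n \in [set: mode]) ((m n)%:R * eps a1 a2 a3 V n)).

(* Canonical partition function Z_V(N) = Tr exp(-beta T_V^(N)) on the symmetric space *)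
Definition Zcan {R : realType} (beta a1 a2 a3 V : R) (N : nat) : \bar R :=
  \esum_(m in config N) (weight beta a1 a2 a3 V m)%:E.

Definition occ {R : realType} (beta a1 a2 a3 V : R) (N : nat) (k : mode) : R :=
  fine (\esum_(m in config N) ((m k)%:R * weight beta a1 a2 a3 V m)%:E)
  / fine (Zcan beta a1 a2 a3 V N).

(* Critical density rho_c = int_0^oo (e^{beta eta}-1)^{-1} F(d eta),
   F(eta) = sqrt2/(3 pi^2) eta^{3/2}, so F(d eta) = sqrt2/(2 pi^2) eta^{1/2} d eta. *)
Definition rho_c {R : realType} (beta : R) : R :=
  fine (\int[@lebesgue_measure R]_(eta in `]0, +oo[%classic)
          ((expR (beta * eta) - 1)^-1 * (Num.sqrt 2 / (2 * pi ^+ 2)) * Num.sqrt eta)%:E).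

(* Main.v *)
Require Import Defs.
From HB Require Import structures.
From mathcomp Require Import all_boot all_order all_algebra.
From mathcomp Require Import all_classical all_reals all_analysis.
From mathcomp Require Import measurable_realfun.
From mathcomp Require Import ring lra zify.
Import Order.TTheory GRing.Theory Num.Theory.
Import numFieldNormedType.Exports.
Local Open Scope classical_set_scope.
Local Open Scope ring_scope.

(** Write [x_k = exp(-beta (eps_k - eps_0))], with [0] the ground state, and
    let [z_N] be the canonical partition function divided by
    [exp(-beta N eps_0)].  Removing particles from mode [k] one at a time gives
    [<N_k> z_N = sum_(1 <= j <= N) x_k^j z_(N-j)], and summing over [k] gives
    [N z_N = sum_(1 <= j <= N) (1 + p_j) z_(N-j)] with
    [1 + p_j = sum_k x_k^j], a product of three one-dimensional Gaussian sums.
    Hence [<N_0> = N - sum_j p_j z_(N-j) / z_N].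

    Up to normalisation [z_N - z_(N-1)] is the law of the number of excited
    particles in the grand canonical state at chemical potential [eps_0]: its
    mean is [B = sum_j p_j] and its variance is [sum_j j p_j].  Comparing
    Gaussian sums with Gaussian integrals gives [B / V -> rho_c] and, because
    [alpha_1 < 1/2], a variance [o(V^2)].  Since [rho > rho_c], Chebyshev's
    inequality yields [z_(N-S) / z_N -> 1] for each fixed [S], so the number of
    excited particles per volume tends to [rho_c].  A single excited mode holds
    at most [1 / (beta (eps_k - eps_0)) = O(V^(2 alpha_1)) = o(V)] particles. *)

Set Implicit Arguments.
Unset Strict Implicit.
Unset Printing Implicit Defensive.

(** * Renewal recursion and its Chebyshev inequality *)

Section renewal.
(** Indices are shifted by one: [p i] is the p_(i+1) of the overview. [B] is the limiting mean and
    [D] bounds the variance. *)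
Variables (R : realType) (p z : nat -> R) (B D : R).
Hypothesis p_ge0 : forall i, 0 <= p i.
Hypothesis z0_gt0 : 0 < z 0%N.
Hypothesis z_le : forall N, z N <= z N.+1.
Hypothesis z_rec : forall N,
  N.+1%:R * z N.+1 = \sum_(0 <= i < N.+1) (1 + p i) * z (N - i)%N.
Hypothesis p_cvg : series p @ \oo --> B.
Hypothesis pD : forall n, \sum_(0 <= i < n) i.+1%:R * p i <= D.

(** Increments of [z], with z_(-1) read as 0: the unnormalised law of the number of excited
    particles. *)
Let Y K := if K is K'.+1 then z K - z K' else z 0%N.

Let Y_ge0 K : 0 <= Y K.
Proof. by case: K => [|K] /=; [exact: ltW|rewrite subr_ge0]. Qed.

Let sumY n : \sum_(0 <= K < n.+1) Y K = z n.
Proof.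
elim: n => [|n IH]; first by rewrite big_nat1.
by rewrite big_nat_recr//= IH addrC subrK.
Qed.

Lemma renewal_homo m n : (m <= n)%N -> z m <= z n.
Proof.
move=> /subnK <-; elim: (n - m)%N => // k IH.
by rewrite addSn (le_trans IH).
Qed.

Lemma renewal_gt0 n : 0 < z n.
Proof. by rewrite (lt_le_trans z0_gt0)// renewal_homo. Qed.

(** Divided by [z N.+1], the left side is the mean occupation of the ground state, so this is
    conservation of particles: all of them minus the excited ones. *)
Lemma renewal_occ0 N :
  \sum_(0 <= i < N.+1) z (N - i)%N
  = N.+1%:R * z N.+1 - \sum_(0 <= i < N.+1) p i * z (N - i)%N.
Proof.
rewrite z_rec -sumrB; apply: eq_bigr => i _; ring.
Qed.

Let sumzrev N : \sum_(0 <= i < N.+1) z (N - i)%N = \sum_(0 <= i < N.+1) z i.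
Proof.
rewrite [RHS]big_nat_rev/=; apply: eq_bigr => i _.
by rewrite add0n subSS.
Qed.

(** In generating functions, passing from [z] to [Y] multiplies by 1 - s, which removes the term 1
    of [1 + p i]. What remains is the recursion of a compound Poisson law with jumps j of rate p_j /
    j. *)
Let Y_rec K : K.+1%:R * Y K.+1 = \sum_(0 <= i < K.+1) p i * Y (K - i)%N.
Proof.
have E n : \sum_(0 <= i < n.+1) p i * z (n - i)%N
   = n.+1%:R * z n.+1 - \sum_(0 <= i < n.+1) z i.
  by rewrite -sumzrev renewal_occ0; ring.
case: K => [|K]; first by have := E 0%N; rewrite !big_nat1 /= !mul1r => ->.
rewrite big_nat_recr//= subnn /=.
have -> : \sum_(0 <= i < K.+1) p i * Y (K.+1 - i)%N =
   \sum_(0 <= i < K.+1) p i * z (K.+1 - i)%N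
   - \sum_(0 <= i < K.+1) p i * z (K - i)%N.
  rewrite -sumrB; apply: eq_big_nat => i /andP[_ iK].
  by rewrite subSn//= mulrBr.
have := E K.+1; rewrite big_nat_recr//= subnn (big_nat_recr K.+1)//=.
move=> /(canRL (addrK _)) ->.
rewrite E.
rewrite -[K.+2%:R]natr1; ring.
Qed.

(** Size biasing: if K has law [Y], then K f(K) has the expectation of sum_j p_j f(K + j), here
    truncated at [L]. A constant [f] gives the first moment, the identity the second. *)
Let swap (f : nat -> R) L :
  \sum_(0 <= K < L) f K.+1 * (K.+1%:R * Y K.+1) =
  \sum_(0 <= j < L) p j * \sum_(0 <= K < L - j) f (K + j).+1 * Y K.
Proof.
elim: L => [|L IH]; first by rewrite !big_geq.
rewrite big_nat_recr//= IH Y_rec mulr_sumr.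
have -> : \sum_(0 <= j < L.+1) p j *
    (\sum_(0 <= K < L.+1 - j) f (K + j).+1 * Y K) =
  \sum_(0 <= j < L.+1) (p j * (\sum_(0 <= K < L - j) f (K + j).+1 * Y K)
     + f L.+1 * (p j * Y (L - j)%N)).
  apply: eq_big_nat => j /andP[_ jL].
  rewrite subSn// big_nat_recr//= subnK//; ring.
rewrite big_split/=; congr (_ + _).
by rewrite big_nat_recr//= subnn [X in _ * X]big_geq// mulr0 addr0.
Qed.

Let P_le n : \sum_(0 <= i < n) p i <= B.
Proof.
rewrite -(cvg_lim _ p_cvg)//; apply: (nondecreasing_cvgn_le (u_ := series p)).
  by apply: nondecreasing_series => i _ _.
by apply/cvg_ex; exists B.
Qed.

Let B_ge0 : 0 <= B. Proof. by apply: le_trans (P_le 0); rewrite big_geq. Qed.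

Lemma renewal_mean_le N : \sum_(0 <= i < N.+1) p i * z (N - i)%N <= B * z N.
Proof.
apply: (@le_trans _ _ ((\sum_(0 <= i < N.+1) p i) * z N)).
  rewrite mulr_suml; apply: ler_sum => i _.
  by rewrite ler_wpM2l// renewal_homo// leq_subr.
by rewrite ler_wpM2r// ltW// renewal_gt0.
Qed.

(** Unnormalised first and second moments of [Y], truncated at [L] so that only finite sums
    occur. *)
Let S1 L := \sum_(0 <= K < L.+1) K%:R * Y K.
Let S2 L := \sum_(0 <= K < L.+1) K%:R * (K%:R * Y K).

Let S1E L : S1 L.+1 = \sum_(0 <= i < L.+1) p i * z (L - i)%N.
Proof.
rewrite /S1 big_nat_recl// mul0r add0r.
transitivity (\sum_(0 <= K < L.+1) 1 * (K.+1%:R * Y K.+1)).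
  by apply: eq_bigr => K _; rewrite mul1r.
rewrite (swap (fun=> 1)); apply: eq_big_nat => i /andP[_ iL]; congr (_ * _).
by rewrite subSn// -sumY; apply: eq_bigr => K _; rewrite mul1r.
Qed.

Let S1_le L : S1 L <= B * z L.
Proof.
case: L => [|L].
  by rewrite /S1 big_nat1 mul0r mulr_ge0// ltW.
rewrite S1E (le_trans (renewal_mean_le L))// ler_wpM2l//.
Qed.

(** Take [f] to be the identity in [swap]: the factor K + i + 1 splits into K, which rebuilds [S1],
    and i + 1, whose weights against [p] are controlled by [D]. *)
Let S2_le L : S2 L <= B * S1 L + D * z L.
Proof.
have D0 : 0 <= D by apply: le_trans (pD 0); rewrite big_geq.
case: L => [|L].
  by rewrite /S2 /S1 !big_nat1 !mul0r mulr0 add0r mulr_ge0// ltW.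
rewrite /S2 big_nat_recl// mul0r add0r (swap (fun K => K%:R)).
apply: (@le_trans _ _ (\sum_(0 <= i < L.+1) (p i * S1 L.+1 +
   i.+1%:R * p i * z L.+1))).
  apply: ler_sum_nat => i /andP[_ iL].
  rewrite -mulrA mulrCA -mulrDr ler_wpM2l//.
  (* The inner sum stops before [L.+1 - i]; completing it to the full range only adds nonnegative
     terms. *)
  apply: (@le_trans _ _ (\sum_(0 <= K < L.+2) (K%:R * Y K + i.+1%:R * Y K))).
    rewrite (@big_cat_nat _ _ _ (L.+1 - i) _ L.+2)/=; [|lia|lia].
    rewrite ler_wpDr//.
      by apply: sumr_ge0 => k _; rewrite -mulrDl mulr_ge0// addr_ge0.
    by apply: ler_sum => K _; rewrite -addnS natrD mulrDl.
  by rewrite big_split/= -mulr_sumr sumY.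
rewrite big_split/= -!mulr_suml.
by rewrite lerD// ler_wpM2r//; [apply: sumr_ge0 => k _; rewrite mulr_ge0|
  rewrite ltW// renewal_gt0].
Qed.

(** [z L - z T] is the mass of [Y] on T < K <= L, so this is Markov's inequality for the truncated
    law. *)
Let markov T L : (T <= L)%N -> T.+1%:R * (z L - z T) <= S1 L.
Proof.
move=> TL; rewrite /S1 (@big_cat_nat _ _ _ T.+1)//=.
rewrite -(sumY L) -(sumY T) (@big_cat_nat _ _ _ T.+1 0 L.+1)//=.
rewrite addrAC subrr add0r ler_wpDl//.
  by apply: sumr_ge0 => k _; rewrite mulr_ge0.
rewrite mulr_sumr; apply: ler_sum_nat => K /andP[TK _].
by rewrite ler_wpM2r// ler_nat.
Qed.

(** Centring at [B], and not at the truncated mean, leaves the term [B * (B * z L - S1 L)] once the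
    square is expanded and [S2_le] is applied. *)
Let chebyshev T L : (T <= L)%N -> B <= T%:R ->
  (T%:R - B) ^+ 2 * (z L - z T) <= D * z L + B * (B * z L - S1 L).
Proof.
move=> TL BT.
apply: (@le_trans _ _ (\sum_(0 <= K < L.+1) (K%:R - B) ^+ 2 * Y K)).
  rewrite -(sumY L) -(sumY T) (@big_cat_nat _ _ _ T.+1 0 L.+1)//=.
  rewrite addrAC subrr add0r [leRHS](@big_cat_nat _ _ _ T.+1)//= ler_wpDl//.
    by apply: sumr_ge0 => k _; rewrite mulr_ge0// sqr_ge0.
  rewrite mulr_sumr; apply: ler_sum_nat => K /andP[TK _].
  have TK' : T%:R <= K%:R :> R by rewrite ler_nat ltnW.
  rewrite ler_wpM2r// ler_sqr ?nnegrE ?subr_ge0// ?lerD2r//.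
  exact: le_trans TK'.
have -> : \sum_(0 <= K < L.+1) (K%:R - B) ^+ 2 * Y K =
   S2 L - 2 * B * S1 L + B ^+ 2 * z L.
  rewrite -sumY /S1 /S2 !mulr_sumr -sumrB -big_split/=.
  by apply: eq_bigr => K _; ring.
have := S2_le L; move: (S1 L) (S2 L) (z L) => s1 s2 s0; nra.
Qed.

(* The deficit [B * z L - S1 L] only vanishes as [L] tends to infinity, which
   is why the tail at [N] is compared with the one at a much larger [L]. *)
Lemma renewal_chebyshev T N : (T <= N)%N -> B <= T%:R ->
  (T%:R - B) ^+ 2 * (1 - z T / z N) <= D.
Proof.
move=> TN BT.
have key m : (T%:R - B) ^+ 2 * (1 - z T / z N) <=
    D + B * ((B - series p m) + B ^+ 2 * m.+1%:R^-1).
  (* [L] exceeds [W] below by [m], so the first [m] terms of [S1E] at [L] all carry a factor at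
     least [z W]. Since [W] exceeds [m], Markov's inequality makes [z W] close to [z L]. Together
     they bound the deficit by a quantity that vanishes with growing [m]. *)
  pose L := (N + m + m).+1.
  have zL := renewal_gt0 L.
  have TL : (T <= L)%N by rewrite /L; lia.
  apply: (@le_trans _ _ ((T%:R - B) ^+ 2 * (1 - z T / z L))).
    rewrite ler_wpM2l ?sqr_ge0// lerB// ler_wpM2l ?(ltW (renewal_gt0 _))//.
    by rewrite lef_pV2 ?posrE ?renewal_gt0// renewal_homo// /L; lia.
  rewrite -(ler_pM2r zL) -mulrA mulrBl mul1r divfK ?gt_eqF//.
  rewrite (le_trans (chebyshev TL BT))// mulrDl lerD2l -mulrA ler_wpM2l//.
  pose W := (N + m).+1.
  have WL : (W <= L)%N by rewrite /L /W; lia.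
  have zW : z W >= z L - B / m.+1%:R * z L.
    have := le_trans (markov WL) (S1_le L).
    have Wm : m.+1%:R <= W.+1%:R :> R by rewrite ler_nat /W; lia.
    rewrite lerBlDr -lerBlDl => h.
    rewrite mulrAC ler_pdivlMr// mulrC.
    by apply: le_trans h; rewrite ler_wpM2r// subr_ge0 renewal_homo.
  have : series p m * z W <= S1 L.
    rewrite S1E [leRHS](@big_cat_nat _ _ _ m)//=; last by lia.
    rewrite ler_wpDr//.
      by apply: sumr_ge0 => i _; rewrite mulr_ge0// ltW// renewal_gt0.
    rewrite seriesEnat/= mulr_suml; apply: ler_sum_nat => i /andP[_ im].
    by rewrite ler_wpM2l// renewal_homo// /W; lia.
  have Pm : series p m <= B by rewrite seriesEnat/=.
  have Pm0 : 0 <= series p m by rewrite seriesEnat/= sumr_ge0.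
  have : series p m * (z L - B / m.+1%:R * z L) <= series p m * z W.
    by rewrite ler_wpM2l.
  have c0 : 0 <= B / m.+1%:R * z L by rewrite !mulr_ge0// ltW.
  have : series p m * (B / m.+1%:R * z L) <= B * (B / m.+1%:R * z L).
    by rewrite ler_wpM2r.
  move: c0; move: (series p m) (z W) (S1 L) => P w s.
  rewrite (_ : B ^+ 2 * _ = B * (B / m.+1%:R)); last ring.
  set c := B / _; move=> c0 h1 h2 h3.
  rewrite (_ : (B - P + B * c) * z L = B * z L - P * z L + B * (c * z L)); last ring.
  nra.
have : (fun m => D + B * ((B - series p m) + B ^+ 2 * m.+1%:R^-1)) @ \oo
   --> D + B * ((B - B) + B ^+ 2 * 0).
  apply: cvgD; first exact: cvg_cst.
  apply: cvgMr; apply: cvgD; first by apply: cvgB => //; exact: cvg_cst.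
  by apply: cvgMr; exact: cvg_harmonic.
rewrite subrr mulr0 addr0 mulr0 addr0 => /cvg_lim lim; rewrite -[leRHS]lim//.
apply: limr_ge; last by apply: nearW.
by apply/cvg_ex; eexists; apply: cvgD; first exact: cvg_cst;
  apply: cvgMr; apply: cvgD; [apply: cvgB; [exact: cvg_cst|exact: p_cvg]|
  apply: cvgMr; exact: cvg_harmonic].
Qed.

(** Lower counterpart of [renewal_mean_le]: only [S] terms are kept, each bounded below through the
    smallest value of [z] among them. Useful for fixed [S], when [z (N.+1 - S)] and [z N.+1] become
    comparable. *)
Lemma renewal_ratio_ge S N : (S <= N)%N ->
  \sum_(0 <= i < S) p i * z (N.+1 - S)%N <=
  \sum_(0 <= i < N.+1) p i * z (N - i)%N.
Proof.
move=> SN; rewrite [leRHS](@big_cat_nat _ _ _ S)//=; last exact: leqW.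
rewrite ler_wpDr//.
  by apply: sumr_ge0 => i _; rewrite mulr_ge0// ltW// renewal_gt0.
apply: ler_sum_nat => i /andP[_ iS].
by rewrite ler_wpM2l// renewal_homo// -[(N - i)%N]subSS leq_sub2l.
Qed.

End renewal.

(** * Recursion for the canonical partition function *)

(** Effect of one more particle in mode [k] on a finitely supported sum. The monoid is kept general
    because both the particle number, in [nat], and the energy, in [R], are updated this way. *)
Lemma fsbig_update1 (T : choiceType) (V : Type) (idx : V)
    (op : Monoid.com_law idx) (f g : T -> V) (k : T) (c : V) :
  finite_set [set n | f n <> idx] -> (forall n, n <> k -> g n = f n) ->
  g k = op c (f k) ->
  \big[op/idx]_(n \in [set: T]) g n = op c (\big[op/idx]_(n \in [set: T]) f n).
Proof.
move=> fin gf gk; pose F := [set n | f n <> idx] `|` [set k].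
have finF : finite_set F by rewrite finite_setU.
have supp n : ~ F n -> n <> k /\ f n = idx.
  by move=> /not_orP[/contrapT ? ?].
have Fk : F k by right.
rewrite -(fsbig_widen F setT g)//; last first.
  by move=> n [_ /supp[nk fn]] /=; rewrite gf.
rewrite -(fsbig_widen F setT f)//; last by move=> n [_ /supp[nk fn]].
rewrite (fsbigD1 k F g)// (fsbigD1 k F f)// gk -Monoid.mulmA.
congr (op _ (op _ _)); apply: eq_fsbigr => n; rewrite inE => -[_ nk].
exact: gf.
Qed.

Lemma esumZl (R : realType) (T : choiceType) (I : set T) (c : R)
    (a : T -> \bar R) : 0 <= c -> (forall i, (0 <= a i)%E) ->
  (\esum_(i in I) (c%:E * a i) = c%:E * \esum_(i in I) a i)%E.
Proof.
move=> c0 a0; rewrite /esum -ereal_supZl//; last first.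
  by apply/set0P; exists 0%E; exists set0;
    [exact: fsets_set0|rewrite fsbig_set0].
congr ereal_sup; apply/seteqP; split => x /=.
  move=> [A fA <-]; exists (\sum_(i \in A) a i)%E; first by exists A.
  by rewrite ge0_mule_fsumr.
by move=> [_ [A fA <-] <-]; exists A => //; rewrite ge0_mule_fsumr.
Qed.

Lemma exchange_esum (R : realType) (T1 T2 : choiceType) (I : set T1)
    (J : set T2) (a : T1 -> T2 -> \bar R) : (forall i j, (0 <= a i j)%E) ->
  \esum_(i in I) \esum_(j in J) a i j = \esum_(j in J) \esum_(i in I) a i j.
Proof.
move=> a0; rewrite (@esum_esum _ _ _ I (fun=> J))//.
rewrite (@esum_esum _ _ _ J (fun=> I))//.
rewrite (reindex_esum (J `*` I) _ (fun x => (x.2, x.1)))//; split=> //=.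
- by move=> [i j] [/=].
- by move=> [i1 i2] [j1 j2] /= _ _ [] -> ->.
- by move=> [i1 i2] [Pi1 Qi2] /=; exists (i2, i1).
Qed.

Definition add_particle (k : mode) (m : mode -> nat) : mode -> nat :=
  fun n => ((n == k) + m n)%N.

Lemma config0 : config 0 = [set fun=> 0%N].
Proof.
apply/seteqP; split => m /=; last first.
  move=> ->; split; first by rewrite (_ : [set _ | _] = set0)// -subset0.
  by split => //; rewrite fsbig1.
move=> [fin [_ s0]]; apply/funext => k; apply/eqP; apply: contraT => mk.
pose m' n := if n == k then 0%N else m n.
move: s0; rewrite (@fsbig_update1 _ _ _ _ m' m k (m k)).
- by move=> /eqP; rewrite addn_eq0 (negbTE mk).
- apply: sub_finite_set fin => n /=; rewrite /m'; by case: eqP.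
- by move=> n /eqP/negbTE; rewrite /m' => ->.
- by rewrite /m' eqxx; exact/esym/addn0.
Qed.

(** The combinatorial core of the recursion: a particle can be taken out of mode [k] exactly when
    that mode is occupied. *)
Lemma config_add_particle N k : is_mode k ->
  set_bij (config N) (config N.+1 `&` [set m | m k <> 0%N]) (add_particle k).
Proof.
move=> kmode; split.
- move=> m [fin [ismode sumN]]; split; last by rewrite /= /add_particle eqxx.
  split.
    apply: (@sub_finite_set _ _ ([set n | m n <> 0%N] `|` [set k])).
      move=> n /=; rewrite /add_particle; case: eqP => [->|_] /=; first by right.
      by rewrite add0n; left.
    by rewrite finite_setU.
  split.
    move=> n; rewrite /add_particle; case: eqP => [->//|_] /=.
    by rewrite add0n; exact: ismode.
  rewrite (@fsbig_update1 _ _ _ _ m _ k 1%N)//.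
  + by rewrite sumN.
  + by move=> n /eqP/negbTE; rewrite /add_particle => ->.
  + by rewrite /add_particle eqxx.
- move=> m m' _ _ mm'; apply/funext => n.
  by move: (congr1 (@^~ n) mm'); rewrite /add_particle => /addnI.
- move=> m [[fin [ismode sumN]] /= mk].
  have mE : add_particle k (fun n => (m n - (n == k))%N) = m.
    apply/funext => n; rewrite /add_particle; case: eqP => [->|] /=; lia.
  exists (fun n => (m n - (n == k))%N) => //.
  have fin' : finite_set [set n | (m n - (n == k))%N <> 0%N].
    by apply: sub_finite_set fin => n /=; lia.
  split=> //; split; first by move=> n h; apply: ismode; lia.
  apply: succn_inj; rewrite -sumN; symmetry.
  apply: (@fsbig_update1 _ _ _ _ (fun n => (m n - (n == k))%N) m k 1%N fin').
    by move=> n /eqP/negbTE ->; rewrite subn0.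
  by rewrite -{1}mE /add_particle eqxx.
Qed.

Section canonical_recursion.
Variables (R : realType) (beta a1 a2 a3 V : R).

Local Notation w := (weight beta a1 a2 a3 V).
Local Notation Z := (Zcan beta a1 a2 a3 V).
Local Notation e := (eps a1 a2 a3 V).

(** One-particle Boltzmann factor; the x_k of the overview is its ratio to the value at
    [(1, 1, 1)]. *)
Definition boltz (k : mode) : R := expR (- beta * e k).
Local Notation y := boltz.

Let w_ge0 m : 0 <= w m. Proof. exact: expR_ge0. Qed.

Let y_ge0 k : 0 <= y k. Proof. exact: expR_ge0. Qed.

Lemma weight_add_particle N k m : config N m ->
  w (add_particle k m) = y k * w m.
Proof.
move=> [fin _]; rewrite /weight /boltz -expRD; congr expR.
rewrite -mulrDr; congr (_ * _).
apply: (@fsbig_update1 _ _ _ _ (fun n => (m n)%:R * e n) _ k (e k)).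
- apply: sub_finite_set fin => n /= + mn; apply.
  by rewrite mn mul0r.
- by move=> n /eqP/negbTE; rewrite /add_particle => ->.
- by rewrite /add_particle eqxx natrD mulrDl mul1r.
Qed.

Lemma esum_config_shift (g : (mode -> nat) -> R) N k : is_mode k ->
  (forall m, 0 <= g m) ->
  (\esum_(m in config N.+1 `&` [set m | m k <> 0%N]) (g m * w m)%:E =
   (y k)%:E * \esum_(m in config N) (g (add_particle k m) * w m)%:E)%E.
Proof.
move=> kmode g0; rewrite (reindex_esum _ _ _ _ (config_add_particle N kmode)).
rewrite -esumZl//; last by move=> m; rewrite lee_fin mulr_ge0.
by apply: eq_esum => m mN; rewrite (weight_add_particle _ mN) mulrCA EFinM.
Qed.

(** Numerator of [occ] before [fine] is applied: the recursions are derived in the extended reals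
    because finiteness is itself deduced from them. *)
Definition occ_sum (k : mode) (N : nat) : \bar R :=
  \esum_(m in config N) ((m k)%:R * w m)%:E.

(** Configurations with mode [k] empty contribute nothing; every other one arises by adding a
    particle to [k], which raises the occupation by one and multiplies the weight by [y k]. *)
Lemma occ_sumS k N : is_mode k ->
  (occ_sum k N.+1 = (y k)%:E * (Z N + occ_sum k N))%E.
Proof.
move=> kmode; rewrite /occ_sum (esumID [set m | m k <> 0%N])/=; last first.
  by move=> m _; rewrite lee_fin mulr_ge0.
rewrite (esum_config_shift (g := fun m => (m k)%:R))//.
rewrite [X in (_ + X)%E]esum1 ?adde0; last first.
  by move=> m [_ /= /contrapT ->]; rewrite mul0r.
congr (_ * _)%E; rewrite -esumD; last 2 first.
- by move=> m _; rewrite lee_fin.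
- by move=> m _; rewrite lee_fin mulr_ge0.
apply: eq_esum => m _.
by rewrite /add_particle eqxx natrD mulrDl mul1r EFinD.
Qed.

Lemma occ_sum0 k : occ_sum k 0 = 0%E.
Proof. by rewrite /occ_sum config0 esum_set1 ?mul0r. Qed.

Lemma Zcan0 : Z 0 = 1%E.
Proof.
rewrite /Zcan config0 esum_set1; last by rewrite lee_fin.
by rewrite /weight fsbig1 ?mulr0 ?expR0// => n _; rewrite mul0r.
Qed.

Lemma Zcan_ge0 N : (0 <= Z N)%E.
Proof. by apply: esum_ge0 => m _; rewrite lee_fin. Qed.

Lemma occ_sumE k N : is_mode k ->
  (occ_sum k N.+1 = \sum_(0 <= i < N.+1) (y k ^+ i.+1)%:E * Z (N - i)%N)%E.
Proof.
move=> kmode; elim: N => [|N IH].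
  by rewrite occ_sumS// occ_sum0 adde0 big_nat1.
rewrite occ_sumS// IH [RHS]big_nat_recl// subn0 expr1 muleDr; last 2 first.
- by [].
- apply: ge0_adde_def; rewrite inE; first exact: Zcan_ge0.
  by apply: sume_ge0 => i _; rewrite mule_ge0 ?Zcan_ge0// lee_fin exprn_ge0.
congr (_ + _)%E; rewrite ge0_sume_distrr//; last first.
  by move=> i _; rewrite mule_ge0 ?Zcan_ge0// lee_fin exprn_ge0.
by apply: eq_bigr => i _; rewrite muleA -EFinM -exprS.
Qed.

(** Keeps only the configurations that occupy [k]. For the ground mode this becomes the monotonicity
    of the normalised partition function. *)
Lemma Zcan_mono k N : is_mode k -> ((y k)%:E * Z N <= Z N.+1)%E.
Proof.
move=> kmode; rewrite {2}/Zcan (esumID [set m | m k <> 0%N])/=; last first.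
  by move=> m _; rewrite lee_fin.
have := @esum_config_shift (fun=> 1) N k kmode (fun=> ler01).
rewrite (eq_esum (b := fun m => (w m)%:E)); last by move=> m _; rewrite mul1r.
move=> ->; rewrite (eq_esum (b := fun m => (w m)%:E)); last first.
  by move=> m _; rewrite mul1r.
by rewrite leeDl//; apply: esum_ge0 => m _; rewrite lee_fin.
Qed.

(** After exchanging the two sums, the occupations of each configuration add up to [N]. *)
Lemma sum_occ_sum N :
  (N%:R%:E * Z N = \esum_(k in [set k | is_mode k]) occ_sum k N)%E.
Proof.
rewrite /occ_sum exchange_esum; last by move=> k m; rewrite lee_fin mulr_ge0.
rewrite -esumZl//; apply: eq_esum => m [fin [ismode sumN]].
under eq_esum do rewrite mulrC EFinM.
rewrite esumZl// muleC; congr (_ * _)%E.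
rewrite -sumN esum_mkcond.
rewrite (@eq_esum _ _ _ _ (fun k => if k \in [set n | m n <> 0%N]
    then (m k)%:R%:E else 0%E)); last first.
  move=> k _; case: ifPn; rewrite ?inE ?notin_setE /=.
    by move=> _; case: ifPn; rewrite ?inE ?notin_setE//= => /contrapT ->.
  move=> kmode; case: ifPn => //; rewrite inE => /= /ismode //.
rewrite -esum_mkcond esum_fset// fsumEFin//; congr EFin.
rewrite -(fsbig_widen [set n | m n <> 0%N] setT m)//; last first.
  by move=> n [_ /contrapT].
by rewrite !fsbig_finite//= raddf_sum.
Qed.

(** [q i] is the one-particle partition function at inverse temperature (i + 1) [beta]; its being a
    real number encodes that this trace is finite. *)
Variable q : nat -> R.
Hypothesis qE : forall i,
  \esum_(k in [set k | is_mode k]) (y k ^+ i.+1)%:E = (q i)%:E.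

Lemma Zcan_rec N :
  (N.+1%:R%:E * Z N.+1 = \sum_(0 <= i < N.+1) (q i)%:E * Z (N - i)%N)%E.
Proof.
rewrite sum_occ_sum (eq_esum (fun k => occ_sumE N (k := k))).
rewrite esum_sum; last first.
  by move=> k i _ _; rewrite mule_ge0 ?Zcan_ge0// lee_fin exprn_ge0.
apply: eq_bigr => i _; rewrite -qE.
(* Finiteness of [Z] is not yet available. If [Z (N - i)] is infinite, both sides are infinite,
   because the ground mode alone already gives a positive factor. *)
have [zoo|zfin] := eqVneq (Z (N - i)) +oo%E; last first.
  have zf : Z (N - i) \is a fin_num.
    by rewrite ge0_fin_numE ?Zcan_ge0// ltey.
  rewrite -(fineK zf) [RHS]muleC -esumZl//.
  - by apply: eq_esum => k _; rewrite muleC.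
  - by rewrite fine_ge0// Zcan_ge0.
  - by move=> k; rewrite lee_fin exprn_ge0.
have q0 : (0 < (q i)%:E)%E.
  rewrite -qE; apply: (@lt_le_trans _ _ (y (1, 1, 1)%N ^+ i.+1)%:E).
    by rewrite lte_fin exprn_gt0// expR_gt0.
  apply: ereal_sup_ubound; exists [set (1, 1, 1)%N]; last by rewrite fsbig_set1.
  by split => // k ->.
rewrite zoo [RHS]gt0_muley ?qE//; apply/eqP; rewrite -leye_eq.
apply: ereal_sup_ubound; exists [set (1, 1, 1)%N].
  by split => // k ->.
by rewrite fsbig_set1 gt0_muley// lte_fin exprn_gt0// expR_gt0.
Qed.

(** By strong induction: the recursion expresses a positive multiple of the next value through
    finitely many finite ones. *)
Lemma Zcan_fin N : Z N \is a fin_num.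
Proof.
suff H n : (n <= N)%N -> Z n \is a fin_num by exact: H.
elim: N n => [|N IH] n; first by rewrite leqn0 => /eqP ->; rewrite Zcan0.
rewrite leq_eqVlt => /orP[/eqP ->|]; last by rewrite ltnS; exact: IH.
have : (N.+1%:R%:E * Z N.+1)%E \is a fin_num.
  rewrite Zcan_rec; apply/sum_fin_numP => i _ _.
  by rewrite fin_numM// IH// leq_subr.
have := Zcan_ge0 N.+1; case: (Z N.+1) => //.
by rewrite gt0_muley// lte_fin.
Qed.

Lemma fine_Zcan_rec N : N.+1%:R * fine (Z N.+1) =
  \sum_(0 <= i < N.+1) q i * fine (Z (N - i)%N).
Proof.
apply: EFin_inj; rewrite EFinM fineK ?Zcan_fin// Zcan_rec -sumEFin.
by apply: eq_bigr => i _; rewrite EFinM fineK ?Zcan_fin.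
Qed.

Lemma fine_Zcan_mono k N : is_mode k -> y k * fine (Z N) <= fine (Z N.+1).
Proof.
move=> kmode; have := Zcan_mono N kmode.
by rewrite -lee_fin EFinM !fineK ?Zcan_fin.
Qed.

Lemma occE k N : is_mode k ->
  occ beta a1 a2 a3 V N.+1 k =
  (\sum_(0 <= i < N.+1) y k ^+ i.+1 * fine (Z (N - i)%N)) / fine (Z N.+1).
Proof.
move=> kmode; rewrite /occ; congr (_ / _).
rewrite -[LHS]/(fine (occ_sum k N.+1)) occ_sumE//.
rewrite (_ : (\sum_(0 <= i < N.+1) _)%E =
   (\sum_(0 <= i < N.+1) y k ^+ i.+1 * fine (Z (N - i)%N))%:E)//.
rewrite -sumEFin; apply: eq_bigr => i _.
by rewrite EFinM fineK ?Zcan_fin.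
Qed.

End canonical_recursion.

(** * Gaussian sums *)

Section zeta_bound.
Variable R : realType.

(** Discrete form of the derivative of x^(-d), obtained from ln(1 - x) <= - x and exp(u) >= 1 + u.
    It makes the sums of powers below telescope. *)
Lemma powRN_gap (d : R) n : 0 < d ->
  d * n.+2%:R `^ (- (1 + d)) <= n.+1%:R `^ (- d) - n.+2%:R `^ (- d).
Proof.
move=> d0; pose x : R := n.+2%:R^-1.
have n2 : 0 < n.+2%:R :> R by [].
have n1 : 0 < n.+1%:R :> R by [].
have x1 : x < 1 by rewrite /x invf_lt1// ltr1n.
have lnE : ln n.+1%:R <= ln n.+2%:R - x :> R.
  have -> : n.+1%:R = n.+2%:R * (1 - x) :> R.
    by rewrite mulrBr mulr1 divff// -(natr1 n.+1) addrK.
  rewrite lnM ?posrE// ?subr_gt0// lerD2l.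
  by have := @le_ln1Dx R (- x); apply; rewrite ltrN2.
have -> : n.+2%:R `^ (- (1 + d)) = x * n.+2%:R `^ (- d) :> R.
  rewrite opprD powRD; last by rewrite (gt_eqF n2) implybT.
  by rewrite powR_inv1// ltW.
rewrite lerBrDr mulrA -[X in _ + X]mul1r -mulrDl addrC.
rewrite /powR (gt_eqF n1) (gt_eqF n2).
apply: (@le_trans _ _ (expR (d * x) * expR (- d * ln n.+2%:R))).
  by rewrite ler_wpM2r ?expR_ge0// expR_ge1Dx.
by rewrite -expRD ler_expR; nra.
Qed.

Lemma sum_powRN_le (q : R) n : 1 < q ->
  \sum_(0 <= i < n) i.+1%:R `^ (- q) <= 1 + (q - 1)^-1.
Proof.
move=> q1; have d0 : 0 < q - 1 by rewrite subr_gt0.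
case: n => [|n].
  by rewrite big_geq// addr_ge0// invr_ge0 ltW.
(* The subtracted power is what [powRN_gap] consumes in the induction; it is dropped afterwards. *)
suff : \sum_(0 <= i < n.+1) i.+1%:R `^ (- q) <=
    1 + (q - 1)^-1 * (1 - n.+1%:R `^ (- (q - 1))).
  move=> /le_trans; apply; rewrite lerD2l; apply: ler_piMr.
    by rewrite invr_ge0 ltW.
  by rewrite lerBlDr lerDl powR_ge0.
elim: n => [|n IH].
  by rewrite big_nat1 !powR1 subrr mulr0 addr0.
rewrite big_nat_recr//= (le_trans (lerD IH (lexx _)))//.
have := powRN_gap n d0; rewrite addrCA subrr addr0.
rewrite -ler_pdivlMl// => h.
by rewrite -addrA lerD2l (le_trans (lerD (lexx _) h))// -mulrDr addrA subrK.
Qed.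

End zeta_bound.

Section gauss_sum.
Variable R : realType.
Implicit Types t p x : R.
Let mu := @lebesgue_measure R.

Lemma itv0y_bigcup_unit :
  `[0, +oo[%classic = \bigcup_(n : nat) `[n%:R, n.+1%:R[%classic :> set R.
Proof.
apply/seteqP; split => [x|x [n _]] /=; rewrite !in_itv/=; last first.
  by move=> /andP[nx _]; rewrite andbT (le_trans _ nx).
rewrite andbT => x0; exists (Num.trunc x) => //=.
by rewrite in_itv/=; exact: Num.Theory.truncn_itv.
Qed.

Lemma trivIset_unit_itv :
  trivIset setT (fun n : nat => `[n%:R, n.+1%:R[%classic : set R).
Proof.
apply/trivIsetP => i j _ _; wlog ij : i j / (i < j)%N => [H|_].
  rewrite neq_lt => /orP[|] ij; first by apply: H => //; rewrite ltn_eqF.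
  by rewrite setIC; apply: H => //; rewrite ltn_eqF.
rewrite -subset0 => x [] /=; rewrite !in_itv/= => /andP[_ xi] /andP[jx _].
have : j%:R < i.+1%:R :> R by exact: le_lt_trans xi.
by rewrite ltr_nat ltnS leqNgt ij.
Qed.

Lemma integral_unit_cst (n : nat) (c : R) :
  (\int[mu]_(x in `[n%:R, n.+1%:R[%classic) c%:E = c%:E)%E.
Proof.
rewrite integral_cst//= lebesgue_measure_itv/= lte_fin ltr_nat ltnS leqnn.
by rewrite -EFinD -natrB// subSnn mule1.
Qed.

Lemma nonincreasing_integral_series (f : R -> R) : continuous f ->
  (forall x, 0 <= f x) -> (forall x y, 0 <= x -> x <= y -> f y <= f x) ->
  (\sum_(n <oo) (f n.+1%:R)%:E <= \int[mu]_(x in `[0%R, +oo[) (f x)%:E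
    <= \sum_(n <oo) (f n%:R)%:E)%E.
Proof.
move=> cf f0 decf.
have mf (D : set R) : measurable D -> measurable_fun D (EFin \o f).
  move=> mD; apply/measurable_EFinP/measurable_funTS.
  exact: continuous_measurable_fun.
rewrite itv0y_bigcup_unit ge0_integral_bigcup//=; last 3 first.
- by apply: mf; exact: bigcup_measurable.
- by move=> x _; rewrite lee_fin.
- exact: trivIset_unit_itv.
apply/andP; split; apply: lee_nneseries => n _.
- by move=> _; rewrite lee_fin.
- rewrite -(integral_unit_cst n); apply: ge0_le_integral => //=.
  + by move=> x _; rewrite lee_fin.
  + exact: mf.
  + move=> x; rewrite in_itv/= => /andP[nx xn]; rewrite lee_fin decf//.
      exact: le_trans nx.
    exact: ltW.
- by move=> _; apply: integral_ge0 => x _; rewrite lee_fin.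
- rewrite -(integral_unit_cst n); apply: ge0_le_integral => //=.
  + by move=> x _; rewrite lee_fin.
  + exact: mf.
  + by move=> x; rewrite in_itv/= => /andP[nx xn]; rewrite lee_fin decf.
Qed.

(** The Gaussian integral of exp(- t x^2) over x >= 0. *)
Definition gaussI t : R := Num.sqrt pi / 2 / Num.sqrt t.

Lemma gaussI_ge0 t : 0 <= gaussI t.
Proof. by rewrite /gaussI !divr_ge0 ?sqrtr_ge0. Qed.

Lemma continuous_gauss_scaled t : continuous (fun x => expR (- t * x ^+ 2)).
Proof.
move=> x; apply: continuous_comp; last exact: continuous_expR.
apply: continuousM; first exact: cst_continuous.
exact: exprn_continuous.
Qed.

Lemma integral0y_gauss_scaled t : 0 < t ->
  (\int[mu]_(x in `[0%R, +oo[) (expR (- t * x ^+ 2))%:E = (gaussI t)%:E)%E.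
Proof.
move=> t0; have st : 0 < Num.sqrt t by rewrite sqrtr_gt0.
have d x : is_derive x 1 (fun y => Num.sqrt t * y) (Num.sqrt t).
  have := @is_deriveZ R R R id (Num.sqrt t) x 1 1 _.
  rewrite /GRing.scale/= mulr1; apply.
have F'E : (fun y => Num.sqrt t * y)^`()%classic = fun=> Num.sqrt t.
  by apply/funext => x; rewrite derive1E; apply: derive_val.
have cF : continuous (fun y : R => Num.sqrt t * y).
  by move=> x; apply: cvgMr; exact: cvg_id.
transitivity ((Num.sqrt t)^-1%:E *
  \int[mu]_(x in `[0%R, +oo[) (expR (- t * x ^+ 2) * Num.sqrt t)%:E)%E.
  under [in RHS]eq_integral do rewrite mulrC EFinM.
  rewrite ge0_integralZl_EFin//=; last first.
    apply/measurable_EFinP/measurable_funTS.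
    by apply: continuous_measurable_fun; exact: continuous_gauss_scaled.
  by rewrite muleA -EFinM mulVf ?mul1e// gt_eqF.
rewrite [X in (_ * X)%E](_ : _ = (Num.sqrt pi / 2)%:E); last first.
  rewrite -integral0y_gauss -{2}(mulr0 (Num.sqrt t)).
  rewrite (@increasing_ge0_integration_by_substitutiony R
    (fun y => Num.sqrt t * y) gauss_fun 0)//.
  - apply: eq_integral => x _; congr EFin; rewrite F'E /gauss_fun.
    rewrite -[RHS]/(expR (- (Num.sqrt t * x) ^+ 2) * Num.sqrt t).
    by rewrite exprMn sqr_sqrtr ?(ltW t0)// mulNr.
  - by move=> x y _ _ xy; rewrite ltr_pM2l.
  - by rewrite F'E => x _; exact: cst_continuous.
  - by rewrite F'E; exact: is_cvg_cst.
  - by rewrite F'E; exact: is_cvg_cst.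
  - split; first by move=> x _; exact: ex_derive.
    by apply: cvg_at_right_filter; exact: cF.
  - exact: gt0_cvgMry.
  - apply: continuous_subspaceT; exact: continuous_gauss_fun.
  - by move=> x _; exact: gauss_fun_ge0.
by rewrite -EFinM mulrC.
Qed.

Let gterm_ge0 t x : (0 <= (expR (- t * x))%:E)%E.
Proof. by rewrite lee_fin expR_ge0. Qed.

(** The exponent is (n + 2)^2 - 1: the sum runs over the levels above the ground level in one
    direction, with energies measured from that level. *)
Definition exc_sum t : \bar R :=
  (\sum_(n <oo) (expR (- t * (n.+1%:R ^+ 2 + 2 * n.+1%:R)))%:E)%E.

Lemma exc_sum_ge0 t : (0 <= exc_sum t)%E.
Proof. by apply: nneseries_ge0 => n _ _. Qed.

Lemma exc_sum_le_gauss_series t : 0 < t ->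
  (exc_sum t <= \sum_(n <oo) (expR (- t * n.+1%:R ^+ 2))%:E)%E.
Proof.
move=> t0; apply: lee_nneseries => n _ //.
by rewrite lee_fin ler_expR !mulNr lerN2 ler_pM2l// lerDl mulr_ge0.
Qed.

Let gauss_decr t x y : 0 < t -> 0 <= x -> x <= y ->
  expR (- t * y ^+ 2) <= expR (- t * x ^+ 2).
Proof.
move=> t0 x0 xy; rewrite ler_expR !mulNr lerN2 ler_pM2l//.
by rewrite ler_sqr// nnegrE// (le_trans x0).
Qed.

Lemma exc_sum_le_gaussI t : 0 < t -> (exc_sum t <= (gaussI t)%:E)%E.
Proof.
move=> t0; rewrite (le_trans (exc_sum_le_gauss_series t0))//.
rewrite -integral0y_gauss_scaled//.
have /andP[+ _] := @nonincreasing_integral_series (fun x => expR (- t * x ^+ 2))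
  (@continuous_gauss_scaled t) (fun=> expR_ge0 _)
  (fun x y => @gauss_decr t x y t0).
exact.
Qed.

Lemma exc_sum_fin t : 0 < t -> exc_sum t \is a fin_num.
Proof.
move=> t0; rewrite ge0_fin_numE ?exc_sum_ge0//.
by rewrite (le_lt_trans (exc_sum_le_gaussI t0))// ltry.
Qed.

Lemma exc_sumE t : (1 + exc_sum t =
  \sum_(n <oo) (expR (- t * (n.+1%:R ^+ 2 - 1)))%:E)%E.
Proof.
rewrite [RHS]nneseries_recl//.
congr (_ + _)%E; first by rewrite expr1n subrr mulr0 expR0.
rewrite -(@nneseries_addn _ _ 1)//.
apply: eq_eseriesr => n _; congr (expR (_ * _))%:E.
by rewrite addn1 -(natr1 n.+1); ring.
Qed.

(** Of the constant 2, one unit is the sample at 0 in the integral comparison, the other is the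
    ground level. *)
Lemma exc_sum_ge_gaussI t : 0 < t -> ((gaussI t)%:E <= 2%:E + exc_sum t)%E.
Proof.
move=> t0; rewrite -integral0y_gauss_scaled//.
have /andP[_ /le_trans] := @nonincreasing_integral_series
  (fun x => expR (- t * x ^+ 2)) (@continuous_gauss_scaled t)
  (fun=> expR_ge0 _) (fun x y => @gauss_decr t x y t0).
apply; rewrite nneseries_recl//.
rewrite expr0n/= mulr0 expR0 (_ : 2%:E = 1 + 1)%E// -addeA leeD2l// exc_sumE.
rewrite -(@nneseries_addn _ _ 1)//.
apply: lee_nneseries => n _ //; rewrite addn1.
by rewrite lee_fin ler_expR !mulNr lerN2 ler_pM2l// lerBlDr lerDl.
Qed.

(** The constant is 3!, from the cubic term of the exponential series, whence the limit 3 on [p]. *)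
Lemma expRN_le_powR x p : 0 < x -> 0 <= p <= 3 -> expR (- x) <= 6 * x `^ (- p).
Proof.
move=> x0 /andP[p0 p3].
rewrite expRN powRN -invf_div lef_pV2 ?posrE ?expR_gt0//; last first.
  by rewrite divr_gt0// powR_gt0.
rewrite ler_pdivrMr//.
have e1 := expR_ge1Dxn 2 (ltW x0).
have x3 : 0 <= x ^+ 3 by rewrite exprn_ge0// ltW.
rewrite (_ : 3`!%:R = 6%:R :> R) in e1; last by [].
have [x1|x1] := leP x 1.
  have : x `^ p <= 1.
    by rewrite -(powRr0 x) ger_powR// x0.
  move: e1 x3; move: (x `^ p) (expR x) (x ^+ 3) => a b c; lra.
have : x `^ p <= x ^+ 3.
  by rewrite -powR_mulrn ?(ltW x0)// ler_powR// ltW.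
move: e1 x3; move: (x `^ p) (expR x) (x ^+ 3) => a b c; lra.
Qed.

(** The Gaussian bound only decays like t^(-1/2). A larger [p] gives up precision at small [t] for
    decay at large [t]; the condition [p] > 1/2 makes the sum of n^(-2p) converge. *)
Lemma exc_sum_le_powR p : 2^-1 < p <= 3 ->
  exists2 C : R, 0 <= C & forall t, 0 < t -> (exc_sum t <= (C * t `^ (- p))%:E)%E.
Proof.
move=> /andP[p2 p3].
have p0 : 0 <= p by apply: le_trans (ltW p2).
have pp : 1 < 2 * p by rewrite -ltr_pdivrMl// mulr1.
exists (6 * (1 + (2 * p - 1)^-1)).
  by rewrite mulr_ge0// addr_ge0// invr_ge0 subr_ge0 ltW.
move=> t t0; rewrite (le_trans (exc_sum_le_gauss_series t0))//.
apply: lime_le; first by apply: is_cvg_nneseries => n _ _; exact: gterm_ge0.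
apply: nearW => n; rewrite sumEFin lee_fin.
apply: (@le_trans _ _ (\sum_(0 <= i < n)
    6 * t `^ (- p) * i.+1%:R `^ (- (2 * p)))).
  apply: ler_sum => i _.
  have i0 : 0 < i.+1%:R ^+ 2 :> R by rewrite exprn_gt0.
  have := @expRN_le_powR (t * i.+1%:R ^+ 2) p (mulr_gt0 t0 i0).
  rewrite p0 p3 mulNr => /(_ isT)/le_trans; apply.
  by rewrite powRM ?(ltW t0) ?(ltW i0)// -powR_mulrn// -powRrM mulrN mulrA.
rewrite -mulr_sumr mulrAC ler_wpM2r ?powR_ge0// ler_wpM2l//.
exact: sum_powRN_le.
Qed.

End gauss_sum.

(** * Critical density *)

Section critical_density.
Variable R : realType.
Implicit Types (g x eta : R).
Let mu := @lebesgue_measure R.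

Lemma integral_expR_tail g (a : R) : 0 < g ->
  (\int[mu]_(x in `[a, +oo[) (expR (- g * x))%:E = (expR (- g * a) / g)%:E)%E.
Proof.
move=> g0; have gn0 : g != 0 by rewrite gt_eqF.
have cexp : continuous (fun x => expR (- g * x)).
  move=> x; apply: continuous_comp; last exact: continuous_expR.
  by apply: cvgMr; exact: cvg_id.
pose F x := - g^-1 * expR (- g * x).
have dF x : is_derive x 1 F (expR (- g * x)).
  have d1 : is_derive x 1 (fun y : R => - g * y) (- g).
    have := @is_deriveZ R R R id (- g) x 1 1 _.
    rewrite /GRing.scale/= mulr1; apply.
  have d2 : is_derive x 1 (fun y => expR (- g * y)) (- g * expR (- g * x)).
    rewrite mulrC; apply: (@is_derive1_comp _ expR (fun y => - g * y)).
  have := @is_deriveZ R R R (fun y => expR (- g * y)) (- g^-1) x 1 _ d2.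
  by rewrite /GRing.scale/= mulrA mulrNN mulVf// mul1r.
rewrite (@ge0_continuous_FTC2y _ _ F _ 0)//.
- by rewrite sub0e -EFinN /F mulNr opprK mulrC.
- exact: continuous_subspaceT.
- rewrite /F -(mulr0 (- g^-1)); apply: cvgMr.
  rewrite (_ : (fun x => expR (- g * x)) =
               (fun z => expR (- z)) \o (fun z => g * z)); last first.
    by apply: eq_fun => x; rewrite mulNr.
  apply: (@cvg_comp _ _ _ _ _ _ (pinfty_nbhs R)); last exact: cvgr_expR.
  exact: gt0_cvgMry.
- by apply: cvg_at_right_filter; apply: cvgMr; exact: cexp.
- by move=> x _; rewrite derive1E; apply: derive_val.
Qed.

(* [sqrt eta] is the length of the [x >= 0] with [x ^+ 2 <= eta], which turns
   the Gamma integral into a Gaussian one by Tonelli. *)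
Lemma integral_sqrt_expR g : 0 < g ->
  (\int[mu]_(eta in `]0%R, +oo[) (Num.sqrt eta * expR (- g * eta))%:E =
   (gaussI g / g)%:E)%E.
Proof.
move=> g0.
pose A : set (R * R) := [set p | 0 <= p.1] `&` [set p | p.1 ^+ 2 <= p.2].
have mA : measurable A.
  apply: measurableI.
    rewrite -[X in measurable X]setTI; apply: measurable_fun_le => //.
  rewrite -[X in measurable X]setTI; apply: measurable_fun_le => //.
  exact: measurable_funX.
pose f (p : R * R) : \bar R := (\1_A p * expR (- g * p.2))%:E.
have f0 p : (0 <= f p)%E by rewrite lee_fin mulr_ge0// expR_ge0.
have mf : measurable_fun setT f.
  apply/measurable_EFinP; apply: measurable_funM; first exact: measurable_indic.
  apply: measurableT_comp => //; exact: measurable_funM.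
have E1 x : (\int[mu]_y f (x, y) =
    ((fun x => (expR (- g * x ^+ 2) / g)%:E) \_ `[0%R, +oo[) x)%E.
  rewrite patchE; case: ifPn; rewrite ?inE ?notin_setE/= in_itv/= andbT => x0.
    rewrite -(integral_expR_tail (x ^+ 2) g0) [RHS]integral_mkcond.
    apply: eq_integral => y _; rewrite patchE /f indicE; case: ifPn.
      rewrite inE/= in_itv/= andbT => xy.
      by rewrite mem_set ?mul1r.
    rewrite notin_setE/= in_itv/= andbT => xy.
    by rewrite memNset ?mul0r// => -[].
  apply: integral0_eq => y _; rewrite /f indicE memNset ?mul0r//.
  by move=> [].
have E2 y : (\int[mu]_x f (x, y) =
    ((fun y => (Num.sqrt y * expR (- g * y))%:E) \_ `[0%R, +oo[) y)%E.
  rewrite patchE; case: ifPn; rewrite ?inE ?notin_setE/= in_itv/= andbT => y0.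
    transitivity (\int[mu]_(x in `[0%R, Num.sqrt y]) (expR (- g * y))%:E)%E.
      rewrite [RHS]integral_mkcond.
      apply: eq_integral => x _; rewrite patchE /f indicE; case: ifPn.
        rewrite inE/= in_itv/= => /andP[x0 xy].
        rewrite mem_set ?mul1r//; split => //=.
        by rewrite -(sqr_sqrtr y0) ler_sqr ?nnegrE// sqrtr_ge0.
      rewrite notin_setE/= in_itv/= => xy.
      rewrite memNset ?mul0r// => -[/= x0 xy2]; apply: xy; rewrite x0/=.
      by rewrite -[leLHS](ger0_norm x0) -sqrtr_sqr ler_sqrt.
    rewrite integral_cst//= lebesgue_measure_itv/= lte_fin.
    have [sy|] := ltP 0 (Num.sqrt y); first by rewrite oppr0 adde0 -EFinM mulrC.
    move=> sy; have -> : Num.sqrt y = 0 by apply/eqP; rewrite eq_le sy sqrtr_ge0.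
    by rewrite mul0r mule0.
  apply: integral0_eq => x _; rewrite /f indicE memNset ?mul0r//.
  move=> [/= _ xy]; apply: y0; exact: le_trans (sqr_ge0 x) xy.
have := fubini_tonelli (m1 := mu) (m2 := mu) f mf f0.
under eq_integral do rewrite E1.
under [in X in _ = X -> _]eq_integral do rewrite E2.
rewrite -!integral_mkcond => E12.
rewrite integral_itv_obnd_cbnd; last first.
  apply/measurable_EFinP; apply: measurable_funTS; apply: measurable_funM.
    by apply: continuous_measurable_fun; exact: sqrt_continuous.
  by apply: measurableT_comp => //; exact: measurable_funM.
rewrite -E12; under eq_integral do rewrite mulrC EFinM.
rewrite ge0_integralZl_EFin//=; last 2 first.
- apply/measurable_EFinP/measurable_funTS.
  by apply: continuous_measurable_fun; exact: continuous_gauss_scaled.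
- by rewrite invr_ge0 ltW.
by rewrite integral0y_gauss_scaled// -EFinM mulrC.
Qed.

(** The density of states of the three-dimensional box factorises: each term of the Bose expansion
    of [rho_c] is a product of three equal one-dimensional Gaussian integrals. *)
Lemma gaussI_cube (b : R) : 0 < b ->
  Num.sqrt 2 / (2 * pi ^+ 2) * (gaussI b / b) = gaussI (pi ^+ 2 / 2 * b) ^+ 3.
Proof.
move=> b0; have p0 : 0 < pi :> R by exact: pi_gt0.
have sE : Num.sqrt (pi ^+ 2 / 2 * b) = pi * (Num.sqrt b / Num.sqrt 2).
  rewrite -mulrA sqrtrM ?sqr_ge0// sqrtr_sqr gtr0_norm//.
  by congr (_ * _); rewrite sqrtrM ?invr_ge0// sqrtrV// mulrC.
have sb : Num.sqrt b != 0 by rewrite gt_eqF// sqrtr_gt0.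
have s2 : Num.sqrt 2 != 0 :> R by rewrite gt_eqF// sqrtr_gt0.
have sp : Num.sqrt pi != 0 :> R by rewrite gt_eqF// sqrtr_gt0.
have eb : b = Num.sqrt b ^+ 2 by rewrite sqr_sqrtr// ltW.
have ep : pi = Num.sqrt pi ^+ 2 :> R by rewrite sqr_sqrtr// ltW.
have e2 : Num.sqrt 2 ^+ 2 = 2 :> R by rewrite sqr_sqrtr.
rewrite /gaussI sE {2}eb.
move: (Num.sqrt b) (Num.sqrt 2) (Num.sqrt pi) ep sb s2 sp e2.
move=> S T P -> S0 T0 P0 e2.
have -> : (P / 2 / (P ^+ 2 * (S / T))) ^+ 3 = T * T ^+ 2 / (8 * P ^+ 3 * S ^+ 3).
  by field; rewrite S0 T0 P0.
by rewrite e2; field; rewrite S0 P0.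
Qed.

Lemma nneseries_EFin (u : nat -> R) (l : R) :
  series u @ \oo --> l -> (\sum_(n <oo) (u n)%:E = l%:E)%E.
Proof.
move=> ul; apply/cvg_lim => //.
rewrite (_ : (fun n => _) = EFin \o series u); last first.
  by apply/funext => n; rewrite sumEFin.
apply: cvg_EFin; first exact: nearW.
exact: ul.
Qed.

Lemma nneseries_geometric_expR (x : R) : 0 < x ->
  (\sum_(n <oo) (expR (- n.+1%:R * x))%:E = ((expR x - 1)^-1)%:E)%E.
Proof.
move=> x0; have e1 : expR (- x) < 1 by rewrite expR_lt1 oppr_lt0.
have ex : 0 < expR x - 1 by rewrite subr_gt0 expR_gt1.
have := @cvg_geometric_series R (expR (- x)) (expR (- x)).
rewrite ger0_norm ?expR_ge0// => /(_ e1) H.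
apply: nneseries_EFin.
rewrite (_ : (fun n => _) = geometric (expR (- x)) (expR (- x))); last first.
  by apply/funext => n; rewrite /geometric/= mulNr -mulrN expRM_natl -exprS.
rewrite (_ : (expR x - 1)^-1 = expR (- x) / (1 - expR (- x)))//.
have e0 : expR x != 0 by rewrite gt_eqF// expR_gt0.
by rewrite expRN; field; rewrite e0 gt_eqF.
Qed.

Lemma series_gaussI_cube (c : R) : 0 < c ->
  cvgn (series (fun i => gaussI (c * i.+1%:R) ^+ 3)).
Proof.
move=> c0; apply: nondecreasing_is_cvgn.
  by apply: nondecreasing_series => i _ _; rewrite exprn_ge0// gaussI_ge0.
exists (gaussI c ^+ 3 * (1 + (3 / 2 - 1)^-1)) => _ [n _ <-].
have q1 : 1 < 3 / 2 :> R by lra.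
rewrite seriesEnat/=.
apply: le_trans (ler_wpM2l (exprn_ge0 3 (gaussI_ge0 c)) (sum_powRN_le n q1)).
rewrite mulr_sumr; apply: ler_sum => i _.
have i0 : 0 <= i.+1%:R :> R by [].
have -> : i.+1%:R `^ (- (3 / 2)) = (Num.sqrt i.+1%:R)^-1 ^+ 3 :> R.
  rewrite -powR12_sqrt// powRN exprVn -[X in _ = X^-1]powR_mulrn ?powR_ge0//.
  by rewrite -powRrM mulrC.
by rewrite /gaussI sqrtrM ?(ltW c0)// invfM mulrA exprMn.
Qed.

(** The Bose factor is expanded as a geometric series and integrated term by term, all terms being
    nonnegative. The sum is finite, so [fine] in [rho_c] hides no infinite value. *)
Lemma rho_c_series (beta : R) : 0 < beta ->
  series (fun i => gaussI (beta * (pi ^+ 2 / 2) * i.+1%:R) ^+ 3) @ \oo -->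
  rho_c beta.
Proof.
move=> b0.
have c0 : 0 < beta * (pi ^+ 2 / 2) :> R.
  by rewrite mulr_gt0// divr_gt0// exprn_gt0// pi_gt0.
have cv := series_gaussI_cube c0.
suff -> : rho_c beta =
  lim (series (fun i => gaussI (beta * (pi ^+ 2 / 2) * i.+1%:R) ^+ 3) @ \oo).
  exact: cv.
rewrite -[RHS]/(fine (_%:E)) -(nneseries_EFin cv) /rho_c; congr fine.
pose C : R := Num.sqrt 2 / (2 * pi ^+ 2).
have C0 : 0 <= C by rewrite divr_ge0 ?sqrtr_ge0// mulr_ge0// sqr_ge0.
transitivity (\int[mu]_(eta in `]0%R, +oo[)
  \sum_(n <oo) (C * (Num.sqrt eta * expR (- (n.+1%:R * beta) * eta)))%:E)%E.
  apply: eq_integral => eta; rewrite inE/= in_itv/= andbT => eta0.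
  under eq_eseriesr do
    rewrite mulrA EFinM -mulNr -[_ * beta * eta]mulrA.
  rewrite nneseriesZl; last by move=> n _; rewrite lee_fin expR_ge0.
  rewrite nneseries_geometric_expR ?mulr_gt0// -EFinM.
  by congr EFin; rewrite -/C; ring.
have mterm (n : nat) : measurable_fun (`]0%R, +oo[%classic : set R)
    (fun eta : R => (Num.sqrt eta * expR (- (n.+1%:R * beta) * eta))%:E).
  apply/measurable_EFinP; apply: measurable_funTS; apply: measurable_funM.
    by apply: continuous_measurable_fun; exact: sqrt_continuous.
  by apply: measurableT_comp => //; exact: measurable_funM.
rewrite integral_nneseries//=; last 2 first.
- by move=> n; exact: (measurable_funeM C%:E (mterm n)).
- by move=> n x _; rewrite lee_fin; apply: mulr_ge0 => //; apply: mulr_ge0.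
apply: eq_eseriesr => n _.
have g0 : 0 < n.+1%:R * beta by rewrite mulr_gt0.
under eq_integral do rewrite EFinM.
rewrite ge0_integralZl_EFin//=; last exact: mterm.
rewrite integral_sqrt_expR// -EFinM gaussI_cube//; congr ((gaussI _) ^+ 3)%:E.
ring.
Qed.

End critical_density.

(** * Excited spectrum *)

Lemma esum_mul (R : realType) (T1 T2 : choiceType) (f : T1 -> R) (g : T2 -> R)
    (F G : R) : (forall i, 0 <= f i) -> (forall j, 0 <= g j) ->
  \esum_(i in [set: T1]) (f i)%:E = F%:E ->
  \esum_(j in [set: T2]) (g j)%:E = G%:E ->
  \esum_(k in [set: T1 * T2]) (f k.1 * g k.2)%:E = (F * G)%:E.
Proof.
move=> f0 g0 fF gG.
have G0 : 0 <= G by rewrite -lee_fin -gG esum_ge0// => j _; rewrite lee_fin.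
transitivity (\esum_(i in [set: T1]) \esum_(j in [set: T2]) (f i * g j)%:E).
  rewrite (@esum_esum _ _ _ [set: T1] (fun=> [set: T2]))//; last first.
    by move=> i j _ _; rewrite lee_fin mulr_ge0.
  by congr esum; apply/seteqP; split.
transitivity (\esum_(i in [set: T1]) (G%:E * (f i)%:E)%E).
  apply: eq_esum => i _; under eq_esum do rewrite EFinM.
  by rewrite esumZl// gG muleC.
by rewrite esumZl// fF -EFinM mulrC.
Qed.

Definition excited (R : realType) (t : R) : R := fine (exc_sum t).

Section mode_sum.
Variable R : realType.
Implicit Type t : R.

Lemma excited_ge0 t : 0 <= excited t.
Proof. by rewrite fine_ge0// exc_sum_ge0. Qed.

Lemma excited_le_gaussI t : 0 < t -> excited t <= gaussI t.
Proof. by move=> t0; rewrite -lee_fin fineK ?exc_sum_fin// exc_sum_le_gaussI. Qed.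

Lemma excited_ge_gaussI t : 0 < t -> gaussI t - 2 <= excited t.
Proof.
move=> t0; rewrite lerBlDl -lee_fin EFinD fineK ?exc_sum_fin//.
exact: exc_sum_ge_gaussI.
Qed.

Lemma excited_le_powR (p : R) : 2^-1 < p <= 3 ->
  exists2 C : R, 0 <= C & forall t, 0 < t -> excited t <= C * t `^ (- p).
Proof.
move=> /exc_sum_le_powR[C C0 H]; exists C => // t t0.
by rewrite -lee_fin fineK ?exc_sum_fin// H.
Qed.

Lemma esum_theta t : 0 < t ->
  \esum_(n in [set: nat]) (expR (- t * (n.+1%:R ^+ 2 - 1)))%:E =
  (1 + excited t)%:E.
Proof.
move=> t0; rewrite EFinD fineK ?exc_sum_fin// exc_sumE nneseries_esumT//.
Qed.

Lemma esum_modes (f : mode -> \bar R) :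
  \esum_(k in [set k | is_mode k]) f k =
  \esum_(k in [set: nat * nat * nat]) f (k.1.1.+1, k.1.2.+1, k.2.+1).
Proof.
apply: (reindex_esum setT _ (fun k => (k.1.1.+1, k.1.2.+1, k.2.+1))); split.
- by move=> [[i j] k] _.
- by move=> [[i j] k] [[i' j'] k'] _ _ /= [-> -> ->].
- move=> [[[|i] [|j]] [|k]]; rewrite /= /is_mode /n1 /n2 /n3 /=;
    try by case=> ? [].
  by move=> _; exists (i, j, k).
Qed.

Lemma esum_modes_theta (t1 t2 t3 : R) : 0 < t1 -> 0 < t2 -> 0 < t3 ->
  \esum_(k in [set k | is_mode k])
    (expR (- t1 * ((n1 k)%:R ^+ 2 - 1)) * expR (- t2 * ((n2 k)%:R ^+ 2 - 1)) *
     expR (- t3 * ((n3 k)%:R ^+ 2 - 1)))%:E =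
  ((1 + excited t1) * (1 + excited t2) * (1 + excited t3))%:E.
Proof.
move=> t10 t20 t30; rewrite esum_modes /n1 /n2 /n3 /=.
apply: (@esum_mul _ _ _ (fun k : nat * nat =>
    expR (- t1 * (k.1.+1%:R ^+ 2 - 1)) * expR (- t2 * (k.2.+1%:R ^+ 2 - 1)))
  (fun n => expR (- t3 * (n.+1%:R ^+ 2 - 1)))).
- by move=> k; rewrite mulr_ge0 ?expR_ge0.
- by move=> k; exact: expR_ge0.
- apply: (@esum_mul _ _ _ (fun n => expR (- t1 * (n.+1%:R ^+ 2 - 1)))
    (fun n => expR (- t2 * (n.+1%:R ^+ 2 - 1)))).
  + by move=> k; exact: expR_ge0.
  + by move=> k; exact: expR_ge0.
  + exact: esum_theta.
  + exact: esum_theta.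
- exact: esum_theta.
Qed.

End mode_sum.

Section excited_spectrum.
Variables (R : realType) (beta : R).
Hypothesis beta_gt0 : 0 < beta.
Implicit Types (a V : R) (i : nat).

(** The parameter [t] for which the one-dimensional excited sum along a side V^a describes the (i +
    1)-st powers of the Boltzmann factors. *)
Definition rate a V i : R :=
  beta * (pi ^+ 2 / 2) * i.+1%:R * V `^ (- (2 * a)).

Definition exc a V i : R := excited (rate a V i).

(** Volume-free part of the Gaussian integral at [rate a V i], which equals [bulk i] times V^a. The
    cubes [bulk i ^+ 3] sum to [rho_c]. *)
Definition bulk i : R := gaussI (beta * (pi ^+ 2 / 2) * i.+1%:R).

Let c_gt0 : 0 < beta * (pi ^+ 2 / 2) :> R.
Proof. by rewrite mulr_gt0// divr_gt0// exprn_gt0// pi_gt0. Qed.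

Let rate_gt0 a V i : 0 < V -> 0 < rate a V i.
Proof. by move=> V0; rewrite mulr_gt0 ?powR_gt0// mulr_gt0. Qed.

Lemma exc_ge0 a V i : 0 <= exc a V i. Proof. exact: excited_ge0. Qed.

Lemma bulk_ge0 i : 0 <= bulk i. Proof. exact: gaussI_ge0. Qed.

Let gaussI_rate a V i : 0 < V -> gaussI (rate a V i) = bulk i * V `^ a.
Proof.
move=> V0; rewrite /bulk /gaussI /rate sqrtrM ?(mulr_ge0 (ltW c_gt0))//.
have -> : Num.sqrt (V `^ (- (2 * a))) = (V `^ a)^-1.
  by rewrite -powR12_sqrt ?powR_ge0// -powRrM -powRN; congr (_ `^ _); field.
by rewrite invfM invrK !mulrA.
Qed.

Lemma exc_le a V i : 0 < V -> exc a V i <= bulk i * V `^ a.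
Proof.
by move=> V0; rewrite -gaussI_rate// excited_le_gaussI// rate_gt0.
Qed.

Lemma exc_ge a V i : 0 < V -> bulk i * V `^ a - 2 <= exc a V i.
Proof.
by move=> V0; rewrite -gaussI_rate// excited_ge_gaussI// rate_gt0.
Qed.

Lemma exc_le_powR (p : R) : 2^-1 < p <= 3 ->
  exists2 C : R, 0 <= C & forall a V i, 0 < V ->
    exc a V i <= C * V `^ (2 * a * p) * i.+1%:R `^ (- p).
Proof.
move=> /excited_le_powR[C C0 H].
exists (C * (beta * (pi ^+ 2 / 2)) `^ (- p)).
  by rewrite mulr_ge0 ?powR_ge0.
move=> a V i V0; rewrite (le_trans (H _ (rate_gt0 a i V0)))//.
rewrite /rate; have := ltW c_gt0; move: (beta * _) => c c0.
rewrite powRM ?powR_ge0 ?mulr_ge0// powRM// -powRrM mulrNN.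
by rewrite le_eqVlt; apply/orP; left; apply/eqP; ring.
Qed.

Variables a1 a2 a3 : R.
Hypotheses (a12 : a2 <= a1) (a23 : a3 <= a2) (a3_gt0 : 0 < a3)
  (asum : a1 + a2 + a3 = 1) (a1_lt : a1 < 1 / 2).

(** The p_(i+1) of the overview: the full product minus the ground mode. *)
Definition excp V i : R :=
  (1 + exc a1 V i) * (1 + exc a2 V i) * (1 + exc a3 V i) - 1.

(** Sorts the excited modes by the directions in which they are excited: all three give the bulk
    term, two or one give corrections of lower order in the volume. *)
Lemma excpE V i : excp V i =
  exc a1 V i * exc a2 V i * exc a3 V i +
  (exc a1 V i * exc a2 V i + exc a1 V i * exc a3 V i + exc a2 V i * exc a3 V i)
  + (exc a1 V i + exc a2 V i + exc a3 V i).
Proof.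
by rewrite /excp; move: (exc a1 V i) (exc a2 V i) (exc a3 V i) => x y z; ring.
Qed.

Lemma excp_ge V i : exc a1 V i * exc a2 V i * exc a3 V i <= excp V i.
Proof.
rewrite excpE; have := (exc_ge0 a1 V i, exc_ge0 a2 V i, exc_ge0 a3 V i).
move: (exc a1 V i) (exc a2 V i) (exc a3 V i) => x y z [[x0 y0] z0].
by rewrite -addrA lerDl !addr_ge0 ?mulr_ge0.
Qed.

Lemma excp_ge0 V i : 0 <= excp V i.
Proof.
by apply: le_trans (excp_ge V i); apply: mulr_ge0; [apply: mulr_ge0|];
  exact: exc_ge0.
Qed.

(** [M] dominates the exponents needed for triples (2/3), pairs (1 - [a3]) and single directions (2
    [a1]). It can be taken below 1 because [a1] < 1/2. Then [q] = 2 / (1 + [M]) exceeds 1, so that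
    sums of i^(-q) converge, while [q * M] stays below 1. *)
Lemma interpolation_exponent : exists M q : R,
  [/\ 2 / 3 <= M, 1 - a3 <= M, 2 * a1 <= M, 1 < q <= 6 / 5 & q * M < 1].
Proof.
pose m : R := Num.max (1 - a3) (2 * a1).
have m1 : m < 1.
  by rewrite /m gt_max; apply/andP; split; [move: a3_gt0|move: a1_lt]; lra.
have m2 : 1 - a3 <= m by rewrite /m le_max lexx.
have m3 : 2 * a1 <= m by rewrite /m le_max lexx orbT.
have m4 : 2 / 3 <= m by apply: le_trans m2; move: a12 a23 asum; lra.
move: m m1 m2 m3 m4 => M M1 M2 M3 M4.
have M0 : 0 < 1 + M by move: M4; lra.
exists M, (2 / (1 + M)); split => //.
  by apply/andP; split; rewrite ?ltr_pdivlMr ?ler_pdivrMr//; move: M1 M4; lra.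
by rewrite mulrAC ltr_pdivrMr//; move: M1; lra.
Qed.

Let powRD_gt0 (x s t : R) : 0 < x -> x `^ (s + t) = x `^ s * x `^ t.
Proof. by move=> x0; rewrite powRD// (gt_eqF x0) implybT. Qed.

(** [single], [pair] and [triple] bring products of one, two or three excited sums under the common
    exponent [M]; the decay in i of the product is [p], 2 [p] or 3 [p]. *)
Let single (M p : R) a C V i : 1 <= V -> 0 <= C -> 0 <= p -> 2 * a <= M ->
  exc a V i <= C * V `^ (2 * a * p) * i.+1%:R `^ (- p) ->
  exc a V i <= C * V `^ (M * p) * i.+1%:R `^ (- p).
Proof.
move=> V1 C0 p0 aM /le_trans; apply.
by rewrite ler_wpM2r ?powR_ge0// ler_wpM2l// ler_powR// ler_wpM2r.
Qed.

Let pair (M p : R) a b C V i : 1 <= V -> 0 <= C -> 0 <= p -> a + b <= M ->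
  exc a V i <= C * V `^ (2 * a * p) * i.+1%:R `^ (- p) ->
  exc b V i <= C * V `^ (2 * b * p) * i.+1%:R `^ (- p) ->
  exc a V i * exc b V i <= C ^+ 2 * V `^ (M * (2 * p)) * i.+1%:R `^ (- (2 * p)).
Proof.
move=> V1 C0 p0 abM ha hb.
have V0 : 0 < V by exact: lt_le_trans V1.
apply: (le_trans (ler_pM (exc_ge0 _ _ _) (exc_ge0 _ _ _) ha hb)).
rewrite [leLHS](_ : _ = C ^+ 2 * V `^ (2 * a * p + 2 * b * p) *
    i.+1%:R `^ (- p + - p)); last first.
  by rewrite !powRD_gt0//; ring.
rewrite (_ : - p + - p = - (2 * p)); last ring.
rewrite ler_wpM2r ?powR_ge0// ler_wpM2l ?sqr_ge0// ler_powR//.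
rewrite (_ : _ + _ = (a + b) * (2 * p)); last ring.
by rewrite ler_wpM2r// mulr_ge0.
Qed.

Let triple (M p : R) C V i : 1 <= V -> 0 <= C -> 0 <= p -> 2 <= 3 * M ->
  exc a1 V i <= C * V `^ (2 * a1 * p) * i.+1%:R `^ (- p) ->
  exc a2 V i <= C * V `^ (2 * a2 * p) * i.+1%:R `^ (- p) ->
  exc a3 V i <= C * V `^ (2 * a3 * p) * i.+1%:R `^ (- p) ->
  exc a1 V i * exc a2 V i * exc a3 V i <=
  C ^+ 3 * V `^ (M * (3 * p)) * i.+1%:R `^ (- (3 * p)).
Proof.
move=> V1 C0 p0 MM h1 h2 h3.
have V0 : 0 < V by exact: lt_le_trans V1.
have := ler_pM (mulr_ge0 (exc_ge0 _ _ _) (exc_ge0 _ _ _)) (exc_ge0 _ _ _)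
  (ler_pM (exc_ge0 _ _ _) (exc_ge0 _ _ _) h1 h2) h3.
move=> /le_trans; apply.
rewrite [leLHS](_ : _ = C ^+ 3 * V `^ (2 * a1 * p + 2 * a2 * p + 2 * a3 * p) *
    i.+1%:R `^ (- p + - p + - p)); last first.
  by rewrite !powRD_gt0//; ring.
rewrite (_ : - p + - p + - p = - (3 * p)); last ring.
rewrite ler_wpM2r ?powR_ge0// ler_wpM2l ?exprn_ge0// ler_powR//.
rewrite (_ : _ + _ = 2 * (a1 + a2 + a3) * p); last ring.
by rewrite asum mulr1 mulrA; apply: ler_wpM2r => //; rewrite mulrC.
Qed.

(** Bounds for the mean and the variance, with r = [M * q]. In the mean, the triple product is
    compared with its exact Gaussian integral and the rest is given decay i^(-q). In the variance,
    decay i^(-2q) absorbs the weight i + 1, since 1 - 2q <= - q. *)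
Lemma excp_sums : exists K r : R, [/\ 0 <= K, r < 1,
  forall V n, 1 <= V -> \sum_(0 <= i < n) excp V i <=
    V * \sum_(0 <= i < n) bulk i ^+ 3 + K * V `^ r
  & forall V n, 1 <= V ->
    \sum_(0 <= i < n) i.+1%:R * excp V i <= K * V `^ (2 * r)].
Proof.
have [M [q [M1 M2 M3 /andP[q1 q2] qM]]] := interpolation_exponent.
have q3 : 1 + - (2 * q) <= - q by move: q1; lra.
have q0 : 0 <= q by apply: ltW; apply: lt_trans q1.
have MM : 2 <= 3 * M by move: M1; lra.
have [pr1 pr2 pr3] : [/\ a1 + a2 <= M, a1 + a3 <= M & a2 + a3 <= M].
  by split; move: a12 a23 asum M2; lra.
have [sg1 sg2 sg3] : [/\ 2 * a1 <= M, 2 * a2 <= M & 2 * a3 <= M].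
  by split; move: a12 a23 M3; lra.
(* Decay per factor: q/2 for pairs in the mean; q for singles in the mean and pairs in the variance;
   2q/3 for triples and 2q for singles in the variance. *)
have [C1 C10 H1] : exists2 C : R, 0 <= C & forall a V i, 0 < V ->
    exc a V i <= C * V `^ (2 * a * (q / 2)) * i.+1%:R `^ (- (q / 2)).
  by apply: exc_le_powR; apply/andP; split; move: q1 q2; lra.
have [C2 C20 H2] : exists2 C : R, 0 <= C & forall a V i, 0 < V ->
    exc a V i <= C * V `^ (2 * a * q) * i.+1%:R `^ (- q).
  by apply: exc_le_powR; apply/andP; split; move: q1 q2; lra.
have [C3 C30 H3] : exists2 C : R, 0 <= C & forall a V i, 0 < V ->
    exc a V i <= C * V `^ (2 * a * (2 * q / 3)) * i.+1%:R `^ (- (2 * q / 3)).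
  by apply: exc_le_powR; apply/andP; split; move: q1 q2; lra.
have [C4 C40 H4] : exists2 C : R, 0 <= C & forall a V i, 0 < V ->
    exc a V i <= C * V `^ (2 * a * (2 * q)) * i.+1%:R `^ (- (2 * q)).
  by apply: exc_le_powR; apply/andP; split; move: q1 q2; lra.
have p1 : 0 <= q / 2 by rewrite divr_ge0.
have p3 : 0 <= 2 * q / 3 by rewrite divr_ge0// mulr_ge0.
have p4 : 0 <= 2 * q by rewrite mulr_ge0.
have e1 : 2 * (q / 2) = q by field.
have e3 : 3 * (2 * q / 3) = 2 * q by field.
pose z : R := 1 + (q - 1)^-1.
have z0 : 0 <= z by rewrite addr_ge0// invr_ge0 subr_ge0 ltW.
pose K1 := 3 * C1 ^+ 2 + 3 * C2.
pose K2 := C3 ^+ 3 + 3 * C2 ^+ 2 + 3 * C4.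
have K10 : 0 <= K1 by rewrite addr_ge0// mulr_ge0// sqr_ge0.
have K20 : 0 <= K2 by rewrite !addr_ge0 ?mulr_ge0 ?sqr_ge0 ?exprn_ge0.
exists ((K1 + K2) * z), (M * q); split.
- by rewrite mulr_ge0// addr_ge0.
- by rewrite mulrC.
- move=> V n V1; have V0 : 0 < V by exact: lt_le_trans V1.
  apply: (@le_trans _ _ (V * (\sum_(0 <= i < n) bulk i ^+ 3) +
      K1 * V `^ (M * q) * \sum_(0 <= i < n) i.+1%:R `^ (- q))).
    rewrite !mulr_sumr -big_split/=; apply: ler_sum => i _.
    rewrite excpE -addrA lerD//.
      apply: (@le_trans _ _ ((bulk i * V `^ a1) * (bulk i * V `^ a2) *
         (bulk i * V `^ a3))).
        have X a := exc_le a i V0; have Y a := exc_ge0 a V i.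
        exact: (ler_pM (mulr_ge0 (Y a1) (Y a2)) (Y a3)
          (ler_pM (Y a1) (Y a2) (X a1) (X a2)) (X a3)).
      rewrite -[in X in _ <= X * _](powRr1 (ltW V0)) -asum.
      rewrite !powRD_gt0//.
      by rewrite le_eqVlt; apply/orP; left; apply/eqP; ring.
    have P12 := pair V1 C10 p1 pr1 (H1 a1 V i V0) (H1 a2 V i V0).
    have P13 := pair V1 C10 p1 pr2 (H1 a1 V i V0) (H1 a3 V i V0).
    have P23 := pair V1 C10 p1 pr3 (H1 a2 V i V0) (H1 a3 V i V0).
    have S1 := single V1 C20 q0 sg1 (H2 a1 V i V0).
    have S2 := single V1 C20 q0 sg2 (H2 a2 V i V0).
    have S3 := single V1 C20 q0 sg3 (H2 a3 V i V0).
    rewrite e1 in P12 P13 P23.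
    have := lerD (lerD (lerD P12 P13) P23) (lerD (lerD S1 S2) S3).
    move=> /le_trans; apply.
    by rewrite le_eqVlt; apply/orP; left; apply/eqP; rewrite /K1; ring.
  rewrite lerD2l -mulrA -[leRHS]mulrA; apply: ler_pM => //.
  - by rewrite mulr_ge0 ?powR_ge0 ?sumr_ge0// => i _; exact: powR_ge0.
  - by rewrite lerDl.
  by rewrite mulrC ler_wpM2r ?powR_ge0// sum_powRN_le.
- move=> V n V1; have V0 : 0 < V by exact: lt_le_trans V1.
  apply: (@le_trans _ _ (K2 * V `^ (M * (2 * q)) *
      \sum_(0 <= i < n) i.+1%:R `^ (- q))).
    rewrite mulr_sumr; apply: ler_sum => i _.
    have P123 := triple V1 C30 p3 MM (H3 a1 V i V0) (H3 a2 V i V0) (H3 a3 V i V0).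
    have P12 := pair V1 C20 q0 pr1 (H2 a1 V i V0) (H2 a2 V i V0).
    have P13 := pair V1 C20 q0 pr2 (H2 a1 V i V0) (H2 a3 V i V0).
    have P23 := pair V1 C20 q0 pr3 (H2 a2 V i V0) (H2 a3 V i V0).
    have S1 := single V1 C40 p4 sg1 (H4 a1 V i V0).
    have S2 := single V1 C40 p4 sg2 (H4 a2 V i V0).
    have S3 := single V1 C40 p4 sg3 (H4 a3 V i V0).
    rewrite e3 in P123.
    apply: (@le_trans _ _ (i.+1%:R * (K2 * V `^ (M * (2 * q)) *
        i.+1%:R `^ (- (2 * q))))).
      rewrite ler_wpM2l// excpE.
      have := lerD (lerD P123 (lerD (lerD P12 P13) P23)) (lerD (lerD S1 S2) S3).
      move=> /le_trans; apply.
      by rewrite le_eqVlt; apply/orP; left; apply/eqP; rewrite /K2; ring.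
    rewrite mulrCA ler_wpM2l ?mulr_ge0 ?powR_ge0//.
    rewrite -[X in X * _](@powRr1 R)// -powRD_gt0//.
    by rewrite ler_powR ?ler1n.
  rewrite -mulrA -[leRHS]mulrA [2 * (M * q)]mulrCA; apply: ler_pM => //.
  - by rewrite mulr_ge0 ?powR_ge0 ?sumr_ge0// => i _; exact: powR_ge0.
  - by rewrite lerDr.
  by rewrite mulrC ler_wpM2r ?powR_ge0// sum_powRN_le.
Qed.

End excited_spectrum.

(** * Partition function relative to the ground state, and occupation numbers *)

Section normalized.
Variables (R : realType) (beta a1 a2 a3 V : R).
Hypotheses (beta_gt0 : 0 < beta) (V_gt0 : 0 < V).

Local Notation y := (boltz beta a1 a2 a3 V).
Local Notation y0 := (y (1, 1, 1)%N).
Local Notation Z := (Zcan beta a1 a2 a3 V).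
Local Notation p := (excp beta a1 a2 a3 V).

Let ground_mode : is_mode (1, 1, 1)%N. Proof. by []. Qed.

Let y0_gt0 : 0 < y0. Proof. exact: expR_gt0. Qed.
Let y0_neq0 : y0 != 0. Proof. by rewrite gt_eqF. Qed.

(** Supplies the hypothesis [qE] of the canonical recursion, with the ground-state factor pulled out
    so that it cancels in [Znorm]. *)
Lemma esum_boltz i : \esum_(k in [set k | is_mode k]) (y k ^+ i.+1)%:E =
  (y0 ^+ i.+1 * (1 + p i))%:E.
Proof.
have r0 a : 0 < rate beta a V i.
  rewrite mulr_gt0 ?powR_gt0// mulr_gt0// mulr_gt0// divr_gt0// exprn_gt0//.
  exact: pi_gt0.
rewrite /excp addrCA subrr addr0 EFinM -esum_modes_theta//.
rewrite -esumZl; last 2 first.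
- by rewrite exprn_ge0// ltW.
- by move=> k; rewrite lee_fin; apply: mulr_ge0 => //; exact: mulr_ge0.
apply: eq_esum => k _; rewrite -EFinM -!expRD /boltz -!expRM_natl -expRD.
congr (expR _)%:E; rewrite /rate /eps /n1 /n2 /n3 /=.
move: (V `^ _) (V `^ _) (V `^ _) => v1 v2 v3; ring.
Qed.

Definition Znorm N : R := fine (Z N) / y0 ^+ N.
Local Notation z := Znorm.

Lemma Znorm0 : z 0 = 1.
Proof. by rewrite /Znorm Zcan0 expr0 divr1. Qed.

Lemma Znorm_le N : z N <= z N.+1.
Proof.
have := fine_Zcan_mono esum_boltz N ground_mode.
rewrite /Znorm ler_pdivlMr ?exprn_gt0// mulrAC ler_pdivrMr ?exprn_gt0//.
by rewrite exprS mulrA => h; rewrite ler_wpM2r ?exprn_ge0 ?(ltW y0_gt0)// mulrC.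
Qed.

Let powE N i : (i < N.+1)%N -> y0 ^+ N.+1 = y0 ^+ i.+1 * y0 ^+ (N - i).
Proof. by move=> iN; rewrite -exprD; congr (_ ^+ _); lia. Qed.

Lemma Znorm_rec N :
  N.+1%:R * z N.+1 = \sum_(0 <= i < N.+1) (1 + p i) * z (N - i)%N.
Proof.
rewrite /Znorm mulrA (fine_Zcan_rec esum_boltz) mulr_suml.
apply: eq_big_nat => i /andP[_ iN]; rewrite (powE iN).
have ei : y0 ^+ i.+1 != 0 by rewrite expf_neq0.
have eN : y0 ^+ (N - i) != 0 by rewrite expf_neq0.
move: (y0 ^+ i.+1) (y0 ^+ (N - i)) (p i) (fine _) ei eN => A B C D A0 B0.
by field; rewrite A0 B0.
Qed.

Lemma occ_Znorm k N : is_mode k ->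
  occ beta a1 a2 a3 V N.+1 k =
  (\sum_(0 <= i < N.+1) (y k / y0) ^+ i.+1 * z (N - i)%N) / z N.+1.
Proof.
move=> km; rewrite (occE esum_boltz)//.
have -> : (z N.+1)^-1 = y0 ^+ N.+1 / fine (Z N.+1).
  by rewrite /Znorm invfM invrK mulrC.
rewrite mulrA; congr (_ / _).
rewrite mulr_suml; apply: eq_big_nat => i /andP[_ iN].
rewrite (powE iN) expr_div_n /Znorm.
have ei : y0 ^+ i.+1 != 0 by rewrite expf_neq0.
have eN : y0 ^+ (N - i) != 0 by rewrite expf_neq0.
move: (y0 ^+ i.+1) (y0 ^+ (N - i)) (y k ^+ i.+1) (fine _) ei eN => A B C D A0 B0.
by field; rewrite A0 B0.
Qed.

Lemma boltz_ratio k i : (y k / y0) ^+ i.+1 =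
  expR (- i.+1%:R * (beta * (eps a1 a2 a3 V k - eps a1 a2 a3 V (1, 1, 1)%N))).
Proof.
rewrite /boltz -expRB -expRM_natl; congr expR; ring.
Qed.

(** Level spacing is smallest along the longest side, of exponent [a1]. Raising a quantum number
    from 1 adds at least 3 to its square; a factor 1 is enough here. *)
Lemma eps_gap k : a2 <= a1 -> a3 <= a1 -> 1 <= V -> is_mode k ->
  k <> (1, 1, 1)%N ->
  pi ^+ 2 / 2 * V `^ (- (2 * a1)) <=
  eps a1 a2 a3 V k - eps a1 a2 a3 V (1, 1, 1)%N.
Proof.
move=> a21 a31 V1; case: k => [[k1 k2] k3] [/= h1 [h2 h3]] kn.
rewrite /eps /n1 /n2 /n3 /= in h1 h2 h3 *.
rewrite -mulrBr ler_wpM2l ?divr_ge0 ?sqr_ge0//.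
have v2 : V `^ (- (2 * a1)) <= V `^ (- (2 * a2)).
  by rewrite ler_powR// lerN2 ler_pM2l.
have v3 : V `^ (- (2 * a1)) <= V `^ (- (2 * a3)).
  by rewrite ler_powR// lerN2 ler_pM2l.
have v1 := powR_ge0 V (- (2 * a1)).
move: (V `^ (- (2 * a1))) (V `^ (- (2 * a2))) (V `^ (- (2 * a3))) v1 v2 v3.
move=> v1 v2 v3 v10 v12 v13.
have sq k : (0 < k)%N -> 1 <= k%:R ^+ 2 :> R.
  by move=> k0; rewrite expr_ge1// ler1n.
have sq2 k : (1 < k)%N -> 2 <= k%:R ^+ 2 :> R.
  move=> k1'; have : 2 <= k%:R :> R by rewrite ler_nat.
  by nra.
have [[s1 s2] s3] := (sq _ h1, sq _ h2, sq _ h3).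
have : (1 < k1)%N || (1 < k2)%N || (1 < k3)%N.
  apply: contra_notT kn; rewrite !negb_or -!leqNgt => /andP[/andP[e1 e2] e3].
  by congr (_, _, _); apply/eqP; rewrite eqn_leq ?e1 ?e2 ?e3.
have G (A1 A2 A3 : R) : 0 <= A1 - 1 -> 0 <= A2 - 1 -> 0 <= A3 - 1 ->
   [\/ 1 <= A1 - 1, 1 <= A2 - 1 | 1 <= A3 - 1] ->
   v1 <= A1 * v1 + A2 * v2 + A3 * v3 - (1 ^+ 2 * v1 + 1 ^+ 2 * v2 + 1 ^+ 2 * v3).
  move=> B1 B2 B3 h.
  rewrite (_ : _ - _ = (A1 - 1) * v1 + (A2 - 1) * v2 + (A3 - 1) * v3); last ring.
  have v20 := le_trans v10 v12; have v30 := le_trans v10 v13.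
  have [[c1 c2] c3] := (mulr_ge0 B1 v10, mulr_ge0 B2 v20, mulr_ge0 B3 v30).
  case: h => h.
  - by have := ler_wpM2r v10 h; lra.
  - by have := ler_wpM2r v20 h; lra.
  - by have := ler_wpM2r v30 h; lra.
move=> h; apply: G; rewrite ?subr_ge0//.
case/orP: h => [/orP[]|] /sq2 h; [apply: Or31|apply: Or32|apply: Or33]; lra.
Qed.

Lemma sum_expR_le (d : R) n : 0 < d ->
  \sum_(0 <= i < n) expR (- i.+1%:R * d) <= d^-1.
Proof.
move=> d0; apply: (@le_trans _ _ (expR d - 1)^-1).
  rewrite -lee_fin -(nneseries_geometric_expR d0) -sumEFin.
  by apply: nneseries_lim_ge => i _; rewrite lee_fin expR_ge0.
rewrite lef_pV2 ?posrE ?subr_gt0 ?expR_gt1//.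
by rewrite lerBrDl expR_ge1Dx.
Qed.

(** As [z] is nondecreasing, the canonical occupation is at most the grand canonical one at the
    ground-state energy, a geometric sum that the spectral gap bounds. *)
Lemma occ_excited_le k N : a2 <= a1 -> a3 <= a1 -> 1 <= V -> is_mode k ->
  k <> (1, 1, 1)%N ->
  0 <= occ beta a1 a2 a3 V N.+1 k
    <= (beta * (pi ^+ 2 / 2))^-1 * V `^ (2 * a1).
Proof.
move=> a21 a31 V1 km kn.
have z0 N' : 0 < z N'.
  by apply: (renewal_gt0 (z := z)); [rewrite Znorm0|exact: Znorm_le].
have zh := renewal_homo Znorm_le.
rewrite occ_Znorm//; apply/andP; split.
  apply: divr_ge0; last exact: ltW.
  apply: sumr_ge0 => i _; apply: mulr_ge0; last exact: ltW.
  by rewrite boltz_ratio expR_ge0.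
rewrite ler_pdivrMr//.
have gap := eps_gap a21 a31 V1 km kn.
set d := eps a1 a2 a3 V k - eps a1 a2 a3 V (1, 1, 1)%N in gap.
have g0 : 0 < pi ^+ 2 / 2 * V `^ (- (2 * a1)).
  by rewrite mulr_gt0 ?powR_gt0// divr_gt0// exprn_gt0// pi_gt0.
have d0 : 0 < d by exact: lt_le_trans gap.
apply: (@le_trans _ _ ((beta * d)^-1 * z N.+1)); last first.
  rewrite ler_wpM2r ?(ltW (z0 _))// -[V `^ _]invrK -powRN -invfM -mulrA.
  by rewrite lef_pV2 ?posrE ?(mulr_gt0 beta_gt0)// ler_pM2l.
apply: (@le_trans _ _ ((\sum_(0 <= i < N.+1) expR (- i.+1%:R * (beta * d)))
    * z N.+1)); last first.
  by rewrite ler_wpM2r ?(ltW (z0 _))// sum_expR_le// mulr_gt0.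
rewrite mulr_suml; apply: ler_sum => i _; rewrite boltz_ratio.
by rewrite ler_wpM2l ?expR_ge0// zh//; lia.
Qed.

Lemma occ_ground N : occ beta a1 a2 a3 V N.+1 (1, 1, 1)%N =
  N.+1%:R - (\sum_(0 <= i < N.+1) p i * z (N - i)%N) / z N.+1.
Proof.
have zN : z N.+1 != 0.
  by rewrite gt_eqF//; apply: (renewal_gt0 (z := z));
    [rewrite Znorm0|exact: Znorm_le].
rewrite occ_Znorm// divff//; under eq_bigr do rewrite expr1n mul1r.
by rewrite (renewal_occ0 Znorm_rec) mulrBl mulfK.
Qed.

End normalized.

(** * Thermodynamic limit *)

(** The lower bounds depend on a truncation [S]: it is fixed first, to bring [l S] near the limit,
    and only then does [N] grow. *)
Lemma squeeze_family_cvg (R : realType) (x U : nat -> R) (L : nat -> nat -> R)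
    (l : nat -> R) (lim : R) :
  (forall S, L S @ \oo --> l S) -> l @ \oo --> lim -> U @ \oo --> lim ->
  (forall S, \forall N \near \oo, L S N <= x N) ->
  (\forall N \near \oo, x N <= U N) -> x @ \oo --> lim.
Proof.
move=> Ll llim Ulim Lx xU; apply/cvgrPdist_lt => e e0.
have e20 : 0 < e / 2 by rewrite divr_gt0.
move/cvgrPdist_lt : llim => /(_ _ e20)[S _ /(_ S (leqnn S)) /= HS].
move/cvgrPdist_lt : (Ll S) => /(_ _ e20) HL.
move/cvgrPdist_lt : Ulim => /(_ _ e0) HU.
near=> N.
have h1 : L S N <= x N by near: N; exact: Lx.
have h2 : x N <= U N by near: N.
have h3 : `|l S - L S N| < e / 2 by near: N.
have h4 : `|lim - U N| < e by near: N.
move: HS h3 h4; rewrite !ltr_norml => /andP[_ HS] /andP[_ h3] /andP[h4 _].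
apply/andP; split; lra.
Unshelve. all: by end_near. Qed.

Lemma cvg_powRN_linear (R : realType) (rho s : R) : 0 < rho -> 0 < s ->
  (fun N : nat => (N.+1%:R / rho) `^ (- s)) @ \oo --> (0 : R).
Proof.
move=> rho0 s0.
have /cvg_at_rightP := @powR_cvg0 R s s0.
move=> /(_ (fun N => rho * N.+1%:R^-1)) H.
have {}H : (fun N => (rho * N.+1%:R^-1) `^ s) @ \oo --> (0 : R).
  apply: H; split; first by move=> n; rewrite mulr_gt0.
  by rewrite -(mulr0 rho); apply: cvgMr; exact: cvg_harmonic.
rewrite (_ : (fun N => _) = (fun N => (rho * N.+1%:R^-1) `^ s))//.
apply/funext => N; rewrite powRN -powR_inv1 ?powR_ge0// -powRAC powR_inv1.
  by rewrite invf_div.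
by rewrite divr_ge0// ltW.
Qed.

Section condensation.
Variables (R : realType) (a1 a2 a3 beta rho : R).
Hypotheses (ha12 : a2 <= a1) (ha23 : a3 <= a2) (ha3 : 0 < a3)
  (hsum : a1 + a2 + a3 = 1) (hbeta : 0 < beta) (ha1 : a1 < 1 / 2)
  (hrho : rho_c beta < rho).

Let bulk_cvg : series (fun i => bulk beta i ^+ 3) @ \oo --> rho_c beta.
Proof. exact: rho_c_series. Qed.

Let bulk_le n : \sum_(0 <= i < n) bulk beta i ^+ 3 <= rho_c beta.
Proof.
rewrite -(cvg_lim _ bulk_cvg)//.
apply: (nondecreasing_cvgn_le (u_ := series (fun i => bulk beta i ^+ 3))).
  by apply: nondecreasing_series => i _ _; rewrite exprn_ge0// bulk_ge0.
by apply/cvg_ex; eexists; exact: bulk_cvg.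
Qed.

Let rho_c_ge0 : 0 <= rho_c beta.
Proof. by apply: le_trans (bulk_le 0); rewrite big_geq. Qed.

Let rho_gt0 : 0 < rho. Proof. exact: le_lt_trans hrho. Qed.

(** Volume of a system of [N.+1] particles; the shift keeps it positive. *)
Let V N : R := N.+1%:R / rho.

Let V_gt0 N : 0 < V N. Proof. by rewrite divr_gt0. Qed.

Let V_pow s : 0 < s -> (fun N => V N `^ (- s)) @ \oo --> (0 : R).
Proof. exact: cvg_powRN_linear. Qed.

Let V_ge1 : \forall N \near \oo, 1 <= V N.
Proof.
have /cvgrPdist_lt/(_ 1 ltr01) H := V_pow ltr01.
near=> N.
have : `|0 - V N `^ (-1)| < 1 by near: N.
rewrite sub0r normrN ger0_norm ?powR_ge0// powR_inv1 ?(ltW (V_gt0 N))//.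
by rewrite invf_lt1// => /ltW.
Unshelve. all: by end_near. Qed.

Local Notation p N := (excp beta a1 a2 a3 (V N)).
Local Notation z N := (Znorm beta a1 a2 a3 (V N)).

(** Mean number of excited particles among [N.+1]. *)
Let X N := (\sum_(0 <= i < N.+1) p N i * z N (N - i)%N) / z N N.+1.

Let z0_gt0 N : 0 < z N 0. Proof. by rewrite Znorm0. Qed.
Let z_le N n : z N n <= z N n.+1. Proof. exact: Znorm_le. Qed.
Let z_rec N n :
  n.+1%:R * z N n.+1 = \sum_(0 <= i < n.+1) (1 + p N i) * z N (n - i)%N.
Proof. exact: Znorm_rec. Qed.
Let z_gt0 N n : 0 < z N n.
Proof. exact: (renewal_gt0 (z0_gt0 N) (z_le N)). Qed.
Let p_ge0 N i : 0 <= p N i. Proof. exact: excp_ge0. Qed.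

(** Sum and integral differ by at most 2, which is negligible against V^a. *)
Lemma excited_scaled_cvg (a : R) i : 0 < a ->
  (fun N => exc beta a (V N) i * V N `^ (- a)) @ \oo --> bulk beta i.
Proof.
move=> a0; have one N : V N `^ a * V N `^ (- a) = 1.
  by rewrite powRN divff// gt_eqF// powR_gt0.
apply: (@squeeze_cvgr _ _ _ _ (fun N => bulk beta i - 2 * V N `^ (- a))
  (fun=> bulk beta i)); last 2 first.
- rewrite -[X in _ --> X]subr0 -[in X in _ --> X](mulr0 2).
  by apply: cvgB; [exact: cvg_cst|apply: cvgMr; exact: V_pow].
- exact: cvg_cst.
apply: nearW => N.
have v0 := powR_ge0 (V N) (- a).
have := ler_wpM2r v0 (exc_le hbeta a i (V_gt0 N)).
have := ler_wpM2r v0 (exc_ge hbeta a i (V_gt0 N)).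
by rewrite mulrBl -mulrA one mulr1 => -> ->.
Qed.

Lemma excited_density_cvg : (fun N => X N / V N) @ \oo --> rho_c beta.
Proof.
have [K [r [K0 r1 sum_p sum_ip]]] := excp_sums hbeta ha12 ha23 ha3 hsum ha1.
have r10 : 0 < 1 - r by rewrite subr_gt0.
pose B N := limn (series (p N)).
have pn_le N n : 1 <= V N ->
    series (p N) n <= V N * rho_c beta + K * V N `^ r.
  move=> V1; rewrite seriesEnat/=; apply: le_trans (sum_p _ _ V1) _.
  by rewrite lerD2r ler_wpM2l ?(ltW (V_gt0 N)).
have p_cvg N : 1 <= V N -> series (p N) @ \oo --> B N.
  move=> V1; apply: nondecreasing_is_cvgn.
    by apply: nondecreasing_series => i _ _.
  by exists (V N * rho_c beta + K * V N `^ r) => _ [n _ <-]; exact: pn_le.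
have B_le N : 1 <= V N -> B N <= V N * rho_c beta + K * V N `^ r.
  move=> V1; apply: limr_le; first exact: p_cvg.
  by apply: nearW => n; exact: pn_le.
have VrE N : V N `^ r = V N * V N `^ (- (1 - r)).
  rewrite -[in X in _ = X * _](powRr1 (ltW (V_gt0 N))) -powRD.
    by congr (_ `^ _); ring.
  by rewrite (gt_eqF (V_gt0 N)) implybT.
(* Half of the excess density: the other half absorbs the error terms, so that [N.+1 - S] stays
   above the mean [B N] by at least [V N * g]. *)
pose g := (rho - rho_c beta) / 2.
have g0 : 0 < g by rewrite divr_gt0// subr_gt0.
(* The first factor keeps the bulk part of the first [S] terms, per unit volume; the second is the
   Chebyshev lower bound for the ratio of partition functions. *)
pose L S N := (\sum_(0 <= i < S)
   ((exc beta a1 (V N) i * V N `^ (- a1)) *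
    (exc beta a2 (V N) i * V N `^ (- a2)) *
    (exc beta a3 (V N) i * V N `^ (- a3)))) *
   (1 - K / g ^+ 2 * (V N `^ (- (1 - r)) * V N `^ (- (1 - r)))).
apply: (@squeeze_family_cvg _ _
  (fun N => rho_c beta + K * V N `^ (- (1 - r))) L
  (series (fun i => bulk beta i ^+ 3))).
- move=> S; rewrite seriesEnat/= -[X in _ --> X]mulr1.
  apply: cvgM; last first.
    rewrite [X in _ --> X](_ : _ = 1 - K / g ^+ 2 * (0 * 0)); last first.
      by rewrite !mulr0 subr0.
    apply: cvgB; first exact: cvg_cst.
    by apply: cvgMr; apply: cvgM; exact: V_pow.
  elim: S => [|S IH].
    by rewrite big_geq//; under eq_fun do rewrite big_geq//; exact: cvg_cst.
  under eq_fun do rewrite big_nat_recr//=; rewrite big_nat_recr//=.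
  apply: cvgD => //; rewrite exprS expr2 mulrA.
  have a20 : 0 < a2 by exact: lt_le_trans ha23.
  have a10 : 0 < a1 by exact: lt_le_trans ha12.
  by apply: cvgM; [apply: cvgM|]; exact: excited_scaled_cvg.
- exact: bulk_cvg.
- rewrite [X in _ --> X](_ : _ = rho_c beta + K * 0); last first.
    by rewrite mulr0 addr0.
  by apply: cvgD; [exact: cvg_cst|apply: cvgMr; exact: V_pow].
- move=> S.
  have small : (fun N => S%:R * V N `^ (- 1) + K * V N `^ (- (1 - r))) @ \oo
      --> (0 : R).
    rewrite [X in _ --> X](_ : _ = S%:R * 0 + K * 0); last first.
      by rewrite !mulr0 addr0.
    by apply: cvgD; apply: cvgMr; exact: V_pow.
  have /cvgrPdist_lt/(_ g g0) Hsmall := small.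
  near=> N.
  have V1 : 1 <= V N by near: N; exact: V_ge1.
  have SN : (S <= N)%N by near: N; exact: nbhs_infty_ge.
  have sm : S%:R * V N `^ (- 1) + K * V N `^ (- (1 - r)) < g.
    have : `|0 - (S%:R * V N `^ (- 1) + K * V N `^ (- (1 - r)))| < g by near: N.
    by rewrite sub0r normrN => /(le_lt_trans (ler_norm _)).
  (* Per unit volume, [rho] minus [rho_c] is 2 [g], and by [sm] the two corrections together cost
     less than [g]. *)
  have TB : V N * g <= (N.+1 - S)%:R - B N.
    rewrite lerBrDr; apply: le_trans (lerD (lexx _) (B_le N V1)) _.
    rewrite natrB ?(leqW SN)// VrE.
    have NE : N.+1%:R = V N * rho by rewrite /V divfK// gt_eqF.
    have SE : S%:R = V N * (S%:R * V N `^ (- 1)).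
      rewrite powR_inv1 ?(ltW (V_gt0 N))// mulrCA divff ?mulr1//.
      by rewrite gt_eqF// V_gt0.
    rewrite NE [in X in _ <= _ - X]SE [K * _]mulrCA -!mulrDr -mulrBr.
    rewrite ler_wpM2l ?(ltW (V_gt0 N))//.
    have : rho = g + g + rho_c beta by rewrite /g; field.
    by move: sm; lra.
  have BT : B N <= (N.+1 - S)%:R.
    rewrite -subr_ge0; apply: le_trans TB.
    by rewrite mulr_ge0 ?(ltW g0) ?(ltW (V_gt0 N)).
  have TN : (N.+1 - S <= N.+1)%N by rewrite leq_subr.
  have := renewal_chebyshev (p_ge0 N) (z0_gt0 N) (z_le N) (z_rec N) (p_cvg N V1)
    (fun n => sum_ip _ n V1) TN BT.
  move=> cheb.
  (* A variance of order V^(2r) against the squared distance (V g)^2 leaves K / g^2 times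
     V^(-2(1-r)), which vanishes because r < 1. *)
  have ratio : 1 - K / g ^+ 2 * (V N `^ (- (1 - r)) * V N `^ (- (1 - r))) <=
      z N (N.+1 - S)%N / z N N.+1.
    rewrite lerBlDr -lerBlDl.
    have ratio1 : 0 <= 1 - z N (N.+1 - S)%N / z N N.+1.
      rewrite subr_ge0 ler_pdivrMr// mul1r.
      exact: (renewal_homo (z_le N) TN).
    have Vg0 : 0 < V N * g by rewrite mulr_gt0.
    have := ler_wpM2r ratio1 (_ : (V N * g) ^+ 2 <= ((N.+1 - S)%:R - B N) ^+ 2).
    rewrite ler_sqr ?nnegrE ?(ltW Vg0)//; last exact: le_trans (ltW Vg0) TB.
    move=> /(_ TB)/le_trans/(_ cheb).
    rewrite -ler_pdivlMl ?exprn_gt0// => /le_trans; apply.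
    rewrite (_ : 2 * r = r + r); last ring.
    rewrite powRD; last by rewrite (gt_eqF (V_gt0 N)) implybT.
    rewrite VrE le_eqVlt; apply/orP; left; apply/eqP.
    have Vn0 : V N != 0 by rewrite gt_eqF.
    have gn0 : g != 0 by rewrite gt_eqF.
    by move: (V N `^ _) => w; field; rewrite Vn0 gn0.
  rewrite /L.
  set E := \sum_(0 <= i < S) _.
  have E0 : 0 <= E.
    apply: sumr_ge0 => i _.
    by apply: mulr_ge0; [apply: mulr_ge0|];
      (apply: mulr_ge0; [exact: exc_ge0|exact: powR_ge0]).
  apply: le_trans (ler_wpM2l E0 ratio) _.
  have EE : E <= (\sum_(0 <= i < S) p N i) / V N.
    rewrite mulr_suml; apply: ler_sum => i _.
    have vE : (V N)^-1 = V N `^ (- a1) * V N `^ (- a2) * V N `^ (- a3).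
      rewrite -!powRD ?(gt_eqF (V_gt0 N)) ?implybT//.
      rewrite -powR_inv1 ?(ltW (V_gt0 N))//; congr (_ `^ _).
      by rewrite -hsum; ring.
    rewrite vE.
    have := excp_ge beta a1 a2 a3 (V N) i.
    have := mulr_ge0 (mulr_ge0 (powR_ge0 (V N) (- a1)) (powR_ge0 (V N) (- a2)))
      (powR_ge0 (V N) (- a3)).
    move=> w0 /(ler_wpM2r w0)/(le_trans _); apply.
    move: (exc _ _ _ _) (exc _ _ _ _) (exc _ _ _ _) => x y t.
    by rewrite le_eqVlt; apply/orP; left; apply/eqP; ring.
  have rat0 : 0 <= z N (N.+1 - S)%N / z N N.+1 by rewrite divr_ge0// ltW.
  apply: le_trans (ler_wpM2r rat0 EE) _.
  have := renewal_ratio_ge (p_ge0 N) (z0_gt0 N) (z_le N) SN.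
  rewrite -mulr_suml => h.
  have c0 : 0 <= (z N N.+1)^-1 / V N by rewrite divr_ge0 ?invr_ge0 ?ltW.
  rewrite /X -[leRHS]mulrA; apply: le_trans (ler_wpM2r c0 h).
  by rewrite le_eqVlt; apply/orP; left; apply/eqP; ring.
(* Upper bound: the canonical mean is at most the grand canonical mean [B N]. *)
- near=> N.
  have V1 : 1 <= V N by near: N; exact: V_ge1.
  rewrite ler_pdivrMr// mulrDl -mulrA [V N `^ _ * _]mulrC -VrE [rho_c _ * _]mulrC.
  apply: le_trans (B_le N V1); rewrite /X ler_pdivrMr//.
  apply: le_trans (renewal_mean_le (p_ge0 N) (z0_gt0 N) (z_le N) (p_cvg N V1) N) _.
  rewrite ler_wpM2l//.
  apply: limr_ge; first exact: p_cvg.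
  by apply: nearW => n; rewrite seriesEnat/= sumr_ge0.
Unshelve. all: by end_near. Qed.

Lemma occ_ground_cvg :
  (fun N => occ beta a1 a2 a3 (V N) N.+1 (1, 1, 1)%N / V N) @ \oo -->
  rho - rho_c beta.
Proof.
rewrite (_ : (fun N => _) = (fun N => rho - X N / V N)).
  by apply: cvgB; [exact: cvg_cst|exact: excited_density_cvg].
apply/funext => N; rewrite occ_ground// mulrBl; congr (_ - _).
by rewrite /V invf_div mulrCA divff ?mulr1.
Qed.

Lemma occ_excited_cvg n : is_mode n -> n <> (1, 1, 1)%N ->
  (fun N => occ beta a1 a2 a3 (V N) N.+1 n / V N) @ \oo --> (0 : R).
Proof.
move=> nm ng; pose c := (beta * (pi ^+ 2 / 2))^-1.
have a31 : a3 <= a1 by exact: le_trans ha12.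
apply: (@squeeze_cvgr _ _ _ _ (fun=> 0)
  (fun N => c * V N `^ (- (1 - 2 * a1)))); last 2 first.
- exact: cvg_cst.
- rewrite -[X in _ --> X](mulr0 c); apply: cvgMr; apply: V_pow.
  by move: ha1; lra.
near=> N.
have V1 : 1 <= V N by near: N; exact: V_ge1.
have /andP[ge0 le1] := occ_excited_le hbeta (V_gt0 N) N ha12 a31 V1 nm ng.
rewrite divr_ge0 ?(ltW (V_gt0 N))//= ler_pdivrMr//.
apply: le_trans le1 _; rewrite -/c -mulrA.
rewrite -[in X in _ <= _ * (_ * X)](powRr1 (ltW (V_gt0 N))) -powRD.
  by rewrite opprB subrK.
by rewrite (gt_eqF (V_gt0 N)) implybT.
Unshelve. all: by end_near. Qed.

End condensation.

Unset Implicit Arguments.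

Theorem theorem3p14 (R : realType) (a1 a2 a3 beta rho : R)
  (ha12 : a2 <= a1) (ha23 : a3 <= a2) (ha3 : 0 < a3) (hsum : a1 + a2 + a3 = 1)
  (hbeta : 0 < beta) (ha1 : a1 < 1 / 2) (hrho : rho_c beta < rho)
  (n : mode) (hn : is_mode n) :
  (fun N : nat => occ beta a1 a2 a3 (N%:R / rho) N n / (N%:R / rho))
    @ \oo --> (if n == (1, 1, 1)%N then rho - rho_c beta else 0).
Proof.
(* Passing to [N.+1] discards the term of volume zero and matches the indexing of the limits
   above. *)
rewrite -cvg_shiftS; case: eqP => [->|ng] /=.
  exact: occ_ground_cvg.
exact: occ_excited_cvg.
Qed.
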